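(* Let $G$ be a (4,6)-fullerene graph with $h$ hexagonal faces. Then $M(G,4)=\frac{27}{8}h^4+\frac{81}{4}h^3+\frac{273}{8}h^2+\frac{117}{4}h+9$, $M(G,5)=\frac{81}{40}h^5+\frac{27}{4}h^4-\frac{9}{8}h^3+\frac{39}{4}h^2-\frac{27}{5}h$, $M(G,6)=\frac{81}{80}h^6-\frac{81}{80}h^5-\frac{99}{16}h^4+\frac{405}{16}h^3-\frac{2833}{40}h^2-\frac{123}{10}h-16+\frac{N(Q)}{6}$.
   Context: A (4,6)-fullerene graph is a plane 3-regular graph all of whose faces are bounded by 4-cycles or 6-cycles, with exactly six square faces; $h$ is the number of hexagonal faces. $M(G,k)$ is the number of $k$-matchings (sets of $k$ pairwise nonadjacent edges) of $G$. $N(Q)$ is the number of (not necessarily induced) subgraphs of $G$ isomorphic to $Q$, the disjoint union of a path with 5 edges and one further edge. *)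

(* Defs.v *)
From mathcomp Require Import all_boot all_fingroup.

Set Implicit Arguments.
Unset Strict Implicit.
Unset Printing Implicit Defensive.

Record sgraph := SGraph {
  vertex :> finType;
  adj : rel vertex;
  adj_sym : symmetric adj;
  adj_irrefl : irreflexive adj }.

Definition edges (G : sgraph) : {set {set G}} :=
  [set [set p.1; p.2] | p : G * G & adj p.1 p.2].

Definition neighbours (G : sgraph) (x : G) : {set G} := [set y | adj x y].

Definition cubic (G : sgraph) : Prop := forall x : G, #|neighbours x| = 3.

Definition connected (G : sgraph) : Prop :=
  forall x y : G, connect (@adj G) x y.

(* M(G,k) *)
Definition matchings (G : sgraph) (k : nat) : {set {set {set G}}} :=
  [set S : {set {set G}} | [&& S \subset edges G, trivIset S & #|S| == k]].

Definition num_matchings (G : sgraph) (k : nat) : nat := #|matchings G k|.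

(* A subgraph is a pair (vertex set, edge set), not necessarily induced. *)
Definition is_subgraph (G : sgraph) (S : {set G} * {set {set G}}) : bool :=
  (S.2 \subset edges G) && [forall a in S.2, a \subset S.1].

Definition isomorphic_to (Q G : sgraph) (S : {set G} * {set {set G}}) : bool :=
  [exists f : {ffun Q -> G},
    [&& injectiveb f, S.1 == f @: [set: Q]
      & S.2 == [set f @: (a : {set Q}) | a in edges Q]]].

(* N(Q) *)
Definition num_subgraphs (Q G : sgraph) : nat :=
  #|[set S : {set G} * {set {set G}} | is_subgraph S && isomorphic_to Q S]|.

Section PathGraph.
Variable n : nat.

Definition path_adj : rel 'I_n := fun i j => (i.+1 == j) || (j.+1 == i).

Lemma path_adj_sym : symmetric path_adj.
Proof. by move=> i j; rewrite /path_adj orbC. Qed.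

Lemma path_adj_irrefl : irreflexive path_adj.
Proof. by move=> i; rewrite /path_adj orbb eqn_leq ltnn. Qed.

(* n vertices, hence n.-1 edges *)
Definition path_graph : sgraph := SGraph path_adj_sym path_adj_irrefl.
End PathGraph.

Section DisjointUnion.
Variables G H : sgraph.

Definition union_adj : rel (G + H)%type := fun u v =>
  match u, v with
  | inl x, inl y => adj x y
  | inr x, inr y => adj x y
  | _, _ => false
  end.

Lemma union_adj_sym : symmetric union_adj.
Proof. by move=> [x|x] [y|y] //=; rewrite adj_sym. Qed.

Lemma union_adj_irrefl : irreflexive union_adj.
Proof. by move=> [x|x] /=; rewrite adj_irrefl. Qed.

Definition disjoint_union : sgraph := SGraph union_adj_sym union_adj_irrefl.
End DisjointUnion.

Definition graphQ : sgraph := disjoint_union (path_graph 6) (path_graph 2).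

(* Plane graphs are represented, up to homeomorphism, by rotation systems of
   genus zero.  A dart is an oriented edge; the rotation at a vertex is the
   cyclic order in which the darts leaving it are met around it. *)
Definition dart (G : sgraph) := {d : G * G | adj d.1 d.2}.

Section Darts.
Variable G : sgraph.

Definition tail (d : dart G) : G := (val d).1.

Lemma rev_dart_proof (d : dart G) : adj (val d).2 (val d).1.
Proof. by rewrite adj_sym; exact: (valP d). Qed.

Definition rev_dart (d : dart G) : dart G :=
  exist (fun d : G * G => adj d.1 d.2) ((val d).2, (val d).1)
    (rev_dart_proof d).

Lemma rev_dart_inj : injective rev_dart.
Proof.
by move=> [[x y] p] [[x' y'] q] [ey ex]; apply: val_inj; rewrite /= ex ey.
Qed.

(* The dart following (x, y) along its face is the rotation of (y, x);
   (s * t)%g x is t (s x). *)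
Definition face_perm (rot : {perm dart G}) : {perm dart G} :=
  (perm rev_dart_inj * rot)%g.
End Darts.

(* Connectedness is required because the faces of a disconnected plane graph
   are not the orbits of face_perm. *)
Record plane_graph := PlaneGraph {
  pgraph :> sgraph;
  rot : {perm dart pgraph};
  rotP : forall d : dart pgraph,
    porbit rot d = [set d' | tail d' == tail d];
  plane_connected : connected pgraph;
  plane_euler : #|pgraph| + #|porbits (face_perm rot)| = #|edges pgraph| + 2 }.

Definition faces (G : plane_graph) : {set {set dart G}} :=
  porbits (face_perm (rot G)).

(* The facial walk has length k and meets k distinct vertices (used only for
   k > 2). *)
Definition bounded_by_cycle (G : plane_graph) (k : nat) (F : {set dart G}) :=
  (#|F| == k) && (#|[set tail d | d in F]| == k).

Definition num_faces (G : plane_graph) (k : nat) : nat :=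
  #|[set F in faces G | bounded_by_cycle k F]|.

Definition is_46fullerene (G : plane_graph) : Prop :=
  [/\ cubic G,
      forall F, F \in faces G -> bounded_by_cycle 4 F || bounded_by_cycle 6 F
    & num_faces G 4 = 6].

(* Main.v *)
(** A k-matching is a labelled copy of [k K_2] up to [2^k k!] relabellings, so
    everything is reduced to counting injective maps of small patterns.  In a
    cubic graph the number [emb H] of such maps satisfies
    [emb (H + isolated vertex) = (n - |H|) emb H] and
    [emb (H + pendant vertex at i) = 3 emb H - \sum_j emb (H + edge ij)],
    because the neighbours of the image of [i] that are already used are exactly
    the [j] giving a copy of [H + ij].  These rules lower the number of vertices
    without raising the number of edges, so with at most six edges they end at
    the empty pattern, at a 4-cycle or at a 6-cycle, once patterns containing a
    vertex of degree 4, an odd cycle or [K_{2,3}] are known not to embed.  The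
    number of 6-cycles enters both [M(G,6)] and [N(Q)], and is eliminated
    between them.

    That the graph is bipartite and that every 4-cycle bounds a face come from
    planarity: by Euler's formula the ranks over [F_2] of the vertex-edge and
    face-edge incidence matrices add up to the number of edges, so each row space
    is the orthogonal complement of the other.  The all-one vector is orthogonal
    to every (even) face, hence is a coboundary: a 2-colouring.  A 4-cycle is the
    boundary of a set of faces; if exactly two of its vertices have their third
    edge on the side of this set, one or two hexagons can be peeled off, leaving
    a smaller set of the same kind, which is absurd; with one or three such
    vertices a face would meet a vertex twice. *)

Require Import Defs.
From Stdlib Require Import ZArith.
From mathcomp Require Import all_boot all_order all_algebra all_fingroup.
From mathcomp Require Import zify lra.
Import GRing.Theory Num.Theory.

Set Implicit Arguments.
Unset Strict Implicit.
Unset Printing Implicit Defensive.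

(** * Labelled copies of patterns *)

Definition pattern := seq (nat * nat).

Definition shift_pattern (l : pattern) : pattern := [seq (e.1.+1, e.2.+1) | e <- l].

Definition C4_pattern : pattern := [:: (0, 1); (1, 2); (2, 3); (3, 0)].

Definition C6_pattern : pattern :=
  [:: (0, 1); (1, 2); (2, 3); (3, 4); (4, 5); (5, 0)].

Definition padj (l : pattern) (a b : nat) : bool :=
  ((a, b) \in l) || ((b, a) \in l).

Definition pnbrs (m : nat) (l : pattern) (a : nat) : seq nat :=
  [seq b <- iota 0 m | padj l a b].

Section Embeddings.
Variables (G : sgraph) (x0 : G).
Implicit Types (l : pattern).

(** A copy is stored as the list of images of the pattern vertices 0, 1, ...; [uniq] is injectivity,
    and the copy need not be induced. *)
Definition embeds l (t : seq G) : bool :=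
  uniq t && all (fun e => adj (nth x0 t e.1) (nth x0 t e.2)) l.

Definition emb (m : nat) l : nat := \sum_(t : m.-tuple G) embeds l t.

Lemma sum_tuple_cons (m : nat) (F : m.+1.-tuple G -> nat) :
  \sum_t F t = \sum_(t : m.-tuple G) \sum_(y : G) F (cons_tuple y t).
Proof.
rewrite exchange_big pair_bigA /=.
rewrite (reindex (fun p : G * m.-tuple G => cons_tuple p.1 p.2)) //=.
exists (fun t => (thead t, behead_tuple t)) => [[y t] _ | t _] /=.
  by congr pair; apply: val_inj.
by rewrite [RHS]tuple_eta; apply: val_inj.
Qed.

Lemma embeds_shift l y (t : seq G) :
  embeds (shift_pattern l) (y :: t) = (y \notin t) && embeds l t.
Proof. by rewrite /embeds /= all_map -andbA. Qed.

Lemma embeds_cons e l (t : seq G) :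
  embeds (e :: l) t = adj (nth x0 t e.1) (nth x0 t e.2) && embeds l t.
Proof. by rewrite /embeds /= andbCA. Qed.

Lemma emb_nil : emb 0 [::] = 1.
Proof.
rewrite /emb (eq_bigr (fun=> 1)) => [|t _]; last by rewrite (tuple0 t).
by rewrite sum1_card card_tuple.
Qed.

(** A copy extends by any vertex that it misses. The used vertices stand on the left to avoid
    truncated subtraction. *)
Lemma emb_isolated (m : nat) l :
  emb m.+1 (shift_pattern l) + m * emb m l = #|G| * emb m l.
Proof.
rewrite /emb sum_tuple_cons !big_distrr -big_split /=; apply: eq_bigr => t _.
under eq_bigr do rewrite embeds_shift.
case: (boolP (embeds l t)) => [/andP[ut _] | _] /=.
  under eq_bigr do rewrite andbT.
  rewrite !muln1 -[in RHS](cardC (mem t)) (card_uniqP ut) size_tuple addnC.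
  by rewrite -sum1_card [in RHS]big_mkcond; congr addn; apply: eq_bigr => y _;
    rewrite !inE; case: (y \in _).
by rewrite big1 ?muln0 // => y _; rewrite andbF.
Qed.

(** The three neighbours of the image of [i] split into those off the copy, which extend it by a
    pendant vertex, and those on it, at some position [j], for which the same list is also a copy of
    the pattern with the edge [ij]. *)
Lemma emb_pendant (m i : nat) l : cubic G ->
  emb m.+1 ((0, i.+1) :: shift_pattern l)
    + \sum_(j < m) emb m ((i, nat_of_ord j) :: l)
  = 3 * emb m l.
Proof.
move=> cubG; rewrite /emb sum_tuple_cons [X in _ + X]exchange_big.
rewrite -big_split big_distrr /=.
apply: eq_bigr => t _.
under eq_bigr do rewrite embeds_cons embeds_shift /=.
under [X in _ + X]eq_bigr do rewrite embeds_cons /=.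
case: (boolP (embeds l t)) => [/andP[ut _] | _] /=; last first.
  by rewrite !big1 // => y _; rewrite !andbF.
rewrite muln1; set x := nth x0 t i; rewrite -(cubG x).
rewrite -(cardID (mem t)) addnC; congr addn.
  rewrite -sum1_card [RHS]big_mkcond [LHS]big_mkcond /=.
  rewrite (eq_bigr (fun j : 'I_m => (adj x (tnth t j) : nat))); last first.
    by move=> j _; rewrite andbT (tnth_nth x0).
  rewrite -(big_tuple _ _ t xpredT (fun y => (adj x y : nat))) /=.
  rewrite big_uniq //= big_mkcond; apply: eq_bigr => y _.
  by rewrite !inE; case: (y \in t); case: (adj x y).
rewrite -sum1_card [RHS]big_mkcond /=; apply: eq_bigr => y _.
by rewrite !inE andbT adj_sym andbC; case: (_ \in _); case: (adj x y).
Qed.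

Lemma embeds_padj l (t : seq G) a b :
  embeds l t -> padj l a b -> adj (nth x0 t a) (nth x0 t b).
Proof.
move=> /andP[_ /allP tl] /orP[] /tl //=; by rewrite adj_sym.
Qed.

(* s is read as the map sending the vertex k of l to the vertex s_k of l'. *)
Definition pattern_map (m : nat) (l l' : pattern) (s : seq nat) : bool :=
  [&& uniq s, size s == m, all (fun k => k < m) s
    & all (fun e => [&& e.1 < m, e.2 < m & padj l' (nth 0 s e.1) (nth 0 s e.2)]) l].

(** The list [s] is a permutation of the vertices, so precomposition with it maps copies of [l']
    injectively to copies of [l]. *)
Lemma emb_map_leq (m : nat) l l' s : pattern_map m l l' s -> emb m l' <= emb m l.
Proof.
case/and4P=> us /eqP ss sm sl.
have szs (t : m.-tuple G) : size [seq nth x0 t k | k <- s] == m by rewrite size_map ss.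
pose f (t : m.-tuple G) : m.-tuple G := Tuple (szs t).
have ms k : k < m -> k \in s.
  move=> km; have [] := uniq_min_size us (s2 := iota 0 m).
  - by move=> x /(allP sm); rewrite mem_iota.
  - by rewrite size_iota ss.
  by move=> _ ->; rewrite mem_iota.
have finj : injective f.
  move=> t t' /(congr1 val) /= /eq_in_map ft; apply: val_inj.
  apply: (@eq_from_nth _ x0); first by rewrite !size_tuple.
  by move=> k; rewrite size_tuple => /ms /ft.
rewrite /emb [X in _ <= X](reindex f) /=; last by apply/onW_bij/injF_bij.
apply: leq_sum => t _; case El': (embeds l' t) => //; rewrite lt0b.
case/andP: (El') => ut _; rewrite /embeds map_inj_in_uniq ?us /=; last first.
  move=> a b /(allP sm) am /(allP sm) bm /eqP.
  by rewrite nth_uniq ?size_tuple // => /eqP.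
apply/allP => e /(allP sl) /and3P[e1 e2 ?].
by rewrite !(nth_map 0) ?ss //; apply: embeds_padj El' _.
Qed.

(** The [index] list is the inverse of [s], so that [emb_map_leq] applies in both directions. *)
Definition pattern_iso (m : nat) (l l' : pattern) (s : seq nat) : bool :=
  pattern_map m l l' s
  && pattern_map m l' l [seq index k s | k <- iota 0 m].

Lemma emb_iso (m : nat) l l' s : pattern_iso m l l' s -> emb m l = emb m l'.
Proof.
by case/andP=> h1 h2; apply/eqP; rewrite eqn_leq (emb_map_leq h1) (emb_map_leq h2).
Qed.

End Embeddings.

(** * Patterns that do not embed *)

Definition walk5 (m : nat) (l : pattern) (a : nat) : seq nat :=
  iter 5 (fun s => flatten (map (pnbrs m l) s)) [:: a].

(* A closed walk of length 5 exists as soon as there is a loop, a triangle or a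
   pentagon. *)
Definition forbidden (m : nat) (l : pattern) : bool :=
  let v := iota 0 m in
  [|| has (fun a => 3 < size (pnbrs m l a)) v,
      has (fun a => a \in walk5 m l a) v
    | has (fun a => has (fun b => (a < b) &&
        (2 < count (fun c => padj l b c) (pnbrs m l a))) v) v].

(** These properties are all that the count uses about the graph. Each of the six squares has 8
    labellings as a 4-cycle, whence 48. *)
Record fullerene_like (G : sgraph) (x0 : G) (h : nat) : Prop := {
  cb_card : #|G| = 2 * h + 8;
  cb_cubic : cubic G;
  cb_colour : exists u : G -> bool, forall x y, adj x y -> u x != u y;
  cb_K23 : forall x y : G, x != y -> #|neighbours x :&: neighbours y| <= 2;
  cb_C4 : emb x0 4 C4_pattern = 48 }.

Section Count.
Variables (G : sgraph) (x0 : G) (h : nat).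
Hypothesis cbG : fullerene_like x0 h.

Lemma forbidden_emb m l : forbidden m l -> emb x0 m l = 0.
Proof.
move=> bad; apply: big1 => t _; apply/eqP; rewrite eqb0; apply/negP => tl.
have ut : uniq t by case/andP: tl.
(* Distinct pattern vertices have distinct images, so degrees and codegrees in the pattern are
   bounded by those in [G]. *)
have img (s : seq nat) (A : {set G}) : uniq s ->
    (forall b, b \in s -> b < m /\ nth x0 t b \in A) -> size s <= #|A|.
  move=> us sA; rewrite -(size_map (nth x0 t)).
  have : uniq [seq nth x0 t b | b <- s].
    rewrite map_inj_in_uniq // => a b /sA[am _] /sA[bm _] /eqP.
    by rewrite nth_uniq ?size_tuple // => /eqP.
  move/card_uniqP <-; apply: subset_leq_card.
  by apply/subsetP => y /mapP[b /sA[_ ?] ->].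
case/or3P: bad.
- case/hasP=> a _; apply/negP; rewrite -leqNgt -(cb_cubic cbG (nth x0 t a)).
  apply: img => [|b]; first by rewrite filter_uniq // iota_uniq.
  rewrite mem_filter mem_iota inE => /andP[ab bm]; split; first exact: bm.
  exact: embeds_padj tl ab.
- have [u hu] := cb_colour cbG; case/hasP=> a _.
  (* The colour alternates along walks, which rules out closed walks of length 5. *)
  suff wk k b : b \in iter k (fun s => flatten (map (pnbrs m l) s)) [:: a] ->
      u (nth x0 t b) = odd k (+) u (nth x0 t a).
    by move/wk; case: (u _).
  elim: k b => [|k IH] b /=; first by rewrite inE => /eqP ->.
  case/flattenP=> _ /mapP[c /IH uc ->]; rewrite mem_filter => /andP[cb _].
  move: (hu _ _ (embeds_padj tl cb)); rewrite uc.
  by case: (odd k); case: (u _); case: (u _).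
- case/hasP=> a am /hasP[b bm] /andP[ab].
  rewrite mem_iota in am; rewrite mem_iota in bm.
  rewrite -size_filter; apply/negP; rewrite -leqNgt.
  apply: leq_trans (cb_K23 cbG (x := nth x0 t a) (y := nth x0 t b) _); last first.
    by rewrite nth_uniq ?size_tuple // neq_ltn ab.
  apply: img => [|c]; first by rewrite !filter_uniq // iota_uniq.
  rewrite !mem_filter mem_iota !inE => /and3P[bc ac cm]; split; first exact: cm.
  by rewrite !(embeds_padj tl).
Qed.

End Count.

(** * Evaluation of patterns with at most six edges *)

Definition vertex_invariant (m : nat) (l : pattern) (a : nat) : nat * nat :=
  let s := pnbrs m l a in
  (size s, sumn [seq size (pnbrs m l b) | b <- s]).

(** A backtracking search that extends the partial map [s] one vertex at a time, pruned by
    [vertex_invariant]; the empty list signals failure. Nothing is proved about it, since [lookup]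
    tests its answer with [pattern_iso]. *)
Fixpoint find_iso (fuel m : nat) (l l' : pattern) (s : seq nat) : seq nat :=
  if fuel is fuel'.+1 then
    (fix try vs := if vs is v :: vs' then
       if v \in s then try vs'
       else if vertex_invariant m l' v != vertex_invariant m l (size s)
       then try vs'
       else if all (fun j => padj l' v (nth 0 s j) == padj l (size s) j)
                   (iota 0 (size s))
       then let r := find_iso fuel' m l l' (rcons s v) in
            if r is [::] then try vs' else r
       else try vs'
     else [::]) (iota 0 m)
  else s.

(* The value (p, c) stands for p(h) + c * N, where N is the number of labelled
   hexagons. *)
Definition value := (seq Z * Z)%type.
Definition entry := (nat * pattern * value)%type.

(** Horner evaluation, with the constant coefficient first. *)
Definition peval (p : seq Z) (x : Z) : Z :=
  foldr (fun c r => Z.add c (Z.mul x r)) Z0 p.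

Fixpoint psub (p q : seq Z) : seq Z :=
  match p, q with
  | a :: p', b :: q' => Z.sub a b :: psub p' q'
  | [::], _ => map Z.opp q
  | _, [::] => p
  end.

Definition pscale (a : Z) (p : seq Z) : seq Z := map (Z.mul a) p.

Fixpoint lookup (tbl : seq entry) (m : nat) (l : pattern) : option value :=
  if tbl is (m', l', v) :: tbl' then
    if m' != m then lookup tbl' m l
    else if pattern_iso m l l' (find_iso m m l l' [::]) then Some v
    else lookup tbl' m l
  else None.

Definition find_value (tbl : seq entry) (m : nat) (l : pattern) : option value :=
  if forbidden m l then Some ([::], Z0) else lookup tbl m l.

Definition sub_value (tbl : seq entry) (m : nat) (l : pattern)
    (v : option value) : option value :=
  match v, find_value tbl m l with
  | Some v, Some w => Some (psub v.1 w.1, Z.sub v.2 w.2)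
  | _, _ => None
  end.

(** As the graph has 2h + 8 vertices, the factor is (8 - m) + 2h; the leading [Z0] multiplies by h.
    A nonzero hexagon coefficient would produce a term h N that a [value] cannot express, hence
    [None]. *)
Definition isolated_value (m : nat) (v : value) : option value :=
  if Z.eqb v.2 Z0 then
    Some (psub (pscale (Z.sub 8 (Z.of_nat m)) v.1)
               (Z0 :: pscale (Zneg 2) v.1), Z0)
  else None.

(** A step whose value cannot be found leaves the table unchanged, and an index out of range denotes
    the empty pattern, so soundness puts no condition on the steps. That they succeed is seen when
    the table is computed. *)
Definition add_entry (tbl : seq entry) (k : nat * option nat) : seq entry :=
  let: (m, l, v) := nth (0, [::], ([:: Zpos 1], Z0)) tbl k.1 in
  match k.2 with
  | None =>
      if isolated_value m v is Some w then rcons tbl (m.+1, shift_pattern l, w) else tbl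
  | Some i =>
      if foldr (fun j => sub_value tbl m ((i, j) :: l))
           (Some (pscale 3 v.1, Z.mul 3 v.2)) (iota 0 m) is Some w
      then rcons tbl (m.+1, (0, i.+1) :: shift_pattern l, w) else tbl
  end.

Definition base_entries : seq entry :=
  [:: (0, [::], ([:: Zpos 1], Z0));
      (4, C4_pattern, ([:: Zpos 48], Z0));
      (6, C6_pattern, ([::], Zpos 1))].

(* (k, None) adds an isolated vertex to the k-th pattern of the table and
   (k, Some i) a pendant vertex at its vertex i; the new vertex is numbered 0.
   Every pattern met by [add_entry] is forbidden or isomorphic to an earlier one. *)
Definition steps : seq (nat * option nat) :=
  [:: (0, None); (3, Some 0); (4, None); (4, Some 0); (5, Some 0); (7, None);
      (6, Some 0); (7, Some 0); (8, Some 0); (11, None); (9, Some 0);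
      (10, Some 0); (11, Some 0); (12, Some 0); (16, None); (1, None);
      (1, Some 0); (18, Some 0); (13, Some 0); (14, Some 0); (15, Some 0);
      (16, Some 0); (17, Some 0); (25, None); (20, None); (19, Some 0);
      (20, Some 0); (20, Some 2); (27, Some 0); (21, Some 5); (22, Some 0);
      (23, Some 0); (24, Some 0); (25, Some 0); (26, Some 0)].

Definition table : seq entry := foldl add_entry base_entries steps.

#[local] Arguments Z.add : simpl never.
#[local] Arguments Z.sub : simpl never.
#[local] Arguments Z.mul : simpl never.
#[local] Arguments Z.of_nat : simpl never.

Lemma psubE p q x : peval (psub p q) x = Z.sub (peval p x) (peval q x).
Proof.
elim: p q => [|a p IH] [|b q] //=; try by rewrite Z.sub_0_r.
  have peval_opp r : peval (map Z.opp r) x = Z.opp (peval r x).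
    by elim: r => //= c r ->; lia.
  by rewrite peval_opp; lia.
by rewrite IH; lia.
Qed.

Lemma pscaleE a p x : peval (pscale a p) x = Z.mul a (peval p x).
Proof. by elim: p => [|b p IH]; rewrite /= ?IH; nia. Qed.

Section Soundness.
Variables (G : sgraph) (x0 : G) (h : nat).
Hypothesis cbG : fullerene_like x0 h.

Definition hexagons : nat :=
  emb x0 6 C6_pattern.

Definition veval (v : value) : Z :=
  Z.add (peval v.1 (Z.of_nat h)) (Z.mul v.2 (Z.of_nat hexagons)).

Definition valid (e : entry) : Prop :=
  Z.of_nat (emb x0 e.1.1 e.1.2) = veval e.2.

Definition all_valid (tbl : seq entry) : Prop :=
  forall k, valid (nth (0, [::], ([:: Zpos 1], Z0)) tbl k).

Lemma valid_nil : valid (0, [::], ([:: Zpos 1], Z0)).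
Proof. by rewrite /valid /= emb_nil /veval /=; lia. Qed.

Lemma all_valid_rcons tbl e : all_valid tbl -> valid e -> all_valid (rcons tbl e).
Proof.
move=> Vt Ve k; rewrite nth_rcons; case: ifP => // _.
by case: ifP => // _; exact: valid_nil.
Qed.

Lemma find_valueP tbl m l v : all_valid tbl -> find_value tbl m l = Some v ->
  Z.of_nat (emb x0 m l) = veval v.
Proof.
move=> Vt; rewrite /find_value; case: ifP => [bad [<-]|_].
  by rewrite (forbidden_emb cbG bad) /veval /=; lia.
elim: tbl Vt => //= [[[m' l'] w] tbl] IH Vt.
have {}IH := IH (fun k => Vt k.+1).
case: eqP => //= Em; subst m'.
by case: ifP => // /(emb_iso x0) -> [<-]; exact: (Vt 0).
Qed.

Lemma add_entryP tbl k : all_valid tbl -> all_valid (add_entry tbl k).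
Proof.
case: k => k o Vt; rewrite /add_entry; have := Vt k.
case: nth => [[m l] v]; rewrite /valid /= => Vk; case: o => [i|]; last first.
  rewrite /isolated_value; case: Z.eqb_spec => // v0.
  apply: all_valid_rcons => //; rewrite /valid /=.
  have := emb_isolated x0 m l; rewrite (cb_card cbG).
  move: Vk; rewrite /veval v0 psubE /= !pscaleE.
  by move: (emb _ m.+1 _) (emb _ m l) (peval _ _) => a b p; nia.
case E: foldr => [w|] //; apply: all_valid_rcons => //; rewrite /valid /=.
have := emb_pendant x0 m i l (cb_cubic cbG).
rewrite -(big_mkord xpredT (fun j => emb x0 m ((i, j) :: l))) /index_iota subn0.
suff -> : veval w = Z.sub (Z.mul 3 (Z.of_nat (emb x0 m l)))
    (Z.of_nat (\sum_(j <- iota 0 m) emb x0 m ((i, j) :: l))) by lia.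
elim: (iota 0 m) w E => [|j s IH] w /=.
  by case=> <-; rewrite big_nil Vk /veval /= pscaleE; lia.
rewrite big_cons {1}/sub_value; case: foldr IH => // u /(_ u erefl) IH.
case F: find_value => [z|] // [<-]; rewrite /veval /= psubE.
by have := find_valueP Vt F; move: IH; rewrite /veval; lia.
Qed.

Lemma tableP : all_valid table.
Proof.
rewrite /table; suff: all_valid base_entries.
  by elim: steps base_entries => //= k s IH tbl Vt; apply/IH/add_entryP.
case=> [|[|[|k]]] /=; first exact: valid_nil.
- by rewrite /valid /= (cb_C4 cbG) /veval /=; lia.
- by rewrite /valid /veval /= -/hexagons; lia.
- by rewrite nth_nil; exact: valid_nil.
Qed.

End Soundness.

(** The numbering is the one that [add_entry] produces for an isolated vertex followed by a pendant
    vertex attached to it, so table entries can be compared syntactically. *)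
Fixpoint matching_pattern (k : nat) : pattern :=
  if k is k'.+1 then (0, 1) :: shift_pattern (shift_pattern (matching_pattern k'))
  else [::].

Definition Q_pattern : pattern :=
  [:: (0, 1); (1, 2); (2, 3); (3, 4); (4, 5); (6, 7)].

Section TableValues.
Local Open Scope Z_scope.

(** The indices are the positions at which [steps] produces these four patterns. Having six edges,
    the hexagon can only contribute to the last two. *)
Lemma table_values :
  [seq nth (0%N, [::], ([:: 1], 0)) table k | k <- [:: 16; 25; 37; 33]%N] =
  [:: (8%N, matching_pattern 4, ([:: 3456; 11232; 13104; 7776; 1296], 0));
      (10%N, matching_pattern 5,
        ([:: 0; -20736; 37440; -4320; 25920; 7776], 0));
      (12%N, matching_pattern 6,
        ([:: -737280; 1829376; -2157696; 1166400; -285120; -46656; 46656], 3840));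
      (8%N, Q_pattern, ([:: 0; 1248; 576], 2))].
Proof. by vm_compute. Qed.

Lemma emb_values (G : sgraph) (x0 : G) (h : nat) (cbG : fullerene_like x0 h) :
  let x := Z.of_nat h in let c := Z.of_nat (hexagons x0) in
  [/\ Z.of_nat (emb x0 8 (matching_pattern 4)) =
        3456 + 11232 * x + 13104 * x ^ 2 + 7776 * x ^ 3 + 1296 * x ^ 4,
      Z.of_nat (emb x0 10 (matching_pattern 5)) =
        - 20736 * x + 37440 * x ^ 2 - 4320 * x ^ 3 + 25920 * x ^ 4 + 7776 * x ^ 5,
      Z.of_nat (emb x0 12 (matching_pattern 6)) =
        - 737280 + 1829376 * x - 2157696 * x ^ 2 + 1166400 * x ^ 3
        - 285120 * x ^ 4 - 46656 * x ^ 5 + 46656 * x ^ 6 + 3840 * c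
    & Z.of_nat (emb x0 8 Q_pattern) = 1248 * x + 576 * x ^ 2 + 2 * c].
Proof.
(* Generalizing over [table] keeps simplification from recomputing it. *)
move=> x c; have := tableP cbG; move: table table_values => tbl [] e4 e5 e6 eQ Vt.
split; [have := Vt 16%N | have := Vt 25%N | have := Vt 37%N | have := Vt 33%N];
  rewrite ?e4 ?e5 ?e6 ?eQ /valid /veval /= -/x -/c => ->; lia.
Qed.

End TableValues.

(** * Matchings as labelled copies *)

Lemma adj_neq (G : sgraph) (x y : G) : adj x y -> x != y.
Proof. by apply: contraTneq => ->; rewrite adj_irrefl. Qed.

Lemma set2_eq (T : finType) (x y a b : T) :
  [set x; y] = [set a; b] -> (x = a /\ y = b) \/ (x = b /\ y = a).
Proof.
move/setP=> E.
have /orP[/eqP xa|/eqP xb] : (x == a) || (x == b)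
  by have := E x; rewrite !inE eqxx => <-.
- subst x; have := E b; rewrite !inE eqxx orbT => /orP[]/eqP ba; last by left.
  by subst b; left; have := E y; rewrite !inE eqxx orbb orbT => /esym/eqP.
- subst x; have := E a; rewrite !inE eqxx => /orP[]/eqP ba; last by right.
  by subst b; left; have := E y; rewrite !inE eqxx orbb orbT => /esym/eqP.
Qed.

Section Matchings.
Variables (G : sgraph) (x0 : G).

Fixpoint pairs (t : seq G) : {set {set G}} :=
  if t is x :: t' then
    if t' is y :: t'' then [set x; y] |: pairs t'' else set0
  else set0.

Lemma mem_edges (x y : G) : ([set x; y] \in edges G) = adj x y.
Proof.
apply/imsetP/idP => [[[a b]] | xy]; last by exists (x, y); rewrite ?inE.
by rewrite inE /= => ab /set2_eq[[-> ->]|[-> ->]]; rewrite // adj_sym.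
Qed.

Lemma sum_edges (F : {set G} -> nat) :
  \sum_(p : G * G | adj p.1 p.2) F [set p.1; p.2] = 2 * \sum_(e in edges G) F e.
Proof.
rewrite (partition_big (fun p : G * G => [set p.1; p.2]) (mem (edges G))) /=;
  last by move=> [x y] /= xy; rewrite mem_edges.
rewrite big_distrr; apply: eq_bigr => e /imsetP[[x y]]; rewrite inE /= => xy ->.
have nxy : x != y by apply: adj_neq.
rewrite (bigD1 (x, y)) /= ?xy ?eqxx // (bigD1 (y, x)) /=; last first.
  by rewrite adj_sym xy setUC eqxx xpair_eqE eq_sym (negPf nxy).
rewrite big1 ?addn0 => [|[a b] /=]; first by rewrite [X in F X]setUC mul2n addnn.
rewrite !xpair_eqE -!andbA => /and4P[ab /eqP E n1 n2].
by case: (set2_eq E) n1 n2 => -[-> ->]; rewrite !eqxx.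
Qed.

(** Double count of the pairs formed by a matching with k + 1 edges and one of these edges, which is
    deleted. *)
Lemma sum_matchings_add (k : nat) (F : {set {set G}} -> nat) :
  \sum_(S in matchings G k) \sum_(e in edges G | [disjoint e & cover S]) F (e |: S)
  = k.+1 * \sum_(S in matchings G k.+1) F S.
Proof.
have -> : k.+1 * \sum_(S in matchings G k.+1) F S
    = \sum_(S in matchings G k.+1) \sum_(e in S) F S.
  rewrite big_distrr; apply: eq_bigr => S; rewrite inE => /and3P[_ _ /eqP Sk].
  by rewrite sum_nat_const Sk.
rewrite !pair_big_dep /=.
rewrite [RHS](reindex_onto (fun p => (p.2 |: p.1, p.2))
  (fun p => (p.1 :\ p.2, p.2))) /=;
  last by move=> [S e] /= /andP[_ eS]; rewrite setD1K.
(* Edges are nonempty, so an edge disjoint from [cover S] is not already in [S]. *)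
have ne0 e : e \in edges G -> e != set0.
  by case/imsetP=> p _ ->; apply/set0Pn; exists p.1; rewrite set21.
apply: eq_bigl => [[S e]] /=; rewrite !inE eqxx /=.
apply/idP/idP.
  case/andP=> /and3P[SE tS /eqP Sk] /andP[eE eS].
  have dS B : B \in S -> [disjoint e & B].
    by move=> BS; apply: disjointWr eS; apply: bigcup_sup.
  have [|tS' eNS] := trivIsetU1 dS tS.
    by apply: contraTN isT => /(subsetP SE) /ne0; rewrite eqxx.
  rewrite subUset sub1set eE SE tS' cardsU1 eNS Sk eqxx /=.
  by rewrite setU1K.
case/andP=> /andP[/and3P[/subsetP SE tS /eqP Sk] _] /eqP[ES].
have eE : e \in edges G by apply: SE; rewrite setU11.
have eNS : e \notin S by rewrite -ES !inE eqxx.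
have SS : S \subset e |: S by apply: subsetUr.
rewrite eE (trivIsetS SS tS); move: Sk; rewrite cardsU1 eNS add1n => -[->].
rewrite eqxx /= andbT; apply/andP; split.
  by apply/subsetP => B BS; rewrite SE ?(subsetP SS).
apply/bigcup_disjointP => B BS; rewrite disjoint_sym.
by apply: (trivIsetP tS); rewrite ?setU11 ?(subsetP SS) //; apply: contraNneq eNS => <-.
Qed.

Lemma cover_pairs k (t : k.*2.-tuple G) : cover (pairs t) =i t.
Proof.
elim: k t => [|k IH] t x; first by rewrite (tuple0 t) /cover big_set0 inE.
case/tupleP: t => y t; case/tupleP: t => z t /=.
have -> : cover ([set y; z] |: pairs t) = [set y; z] :|: cover (pairs t).
  by rewrite /cover bigcup_setU big_set1.
by rewrite !inE IH orbA.
Qed.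

(** The factor counts the orientations and orders of the [k] edges. The weight [F] carries the
    induction: the first edge is peeled off and absorbed into a new weight on the smaller
    matching. *)
Lemma sum_matchings (k : nat) (F : {set {set G}} -> nat) :
  \sum_(t : k.*2.-tuple G) embeds x0 (matching_pattern k) t * F (pairs t)
  = 2 ^ k * k`! * \sum_(S in matchings G k) F S.
Proof.
elim: k F => [|k IH] F.
  rewrite [LHS](eq_bigr (fun=> F set0)) => [|t _]; last by rewrite (tuple0 t) mul1n.
  rewrite sum_nat_const card_tuple !mul1n (big_pred1 set0) // => S; rewrite !inE.
  by apply/idP/eqP => [/and3P[_ _ /eqP/cards0_eq]//|->];
    rewrite sub0set cards0 eqxx andbT; apply/trivIsetP => A B; rewrite inE.
have -> : 2 ^ k.+1 * (k.+1)`! * \sum_(S in matchings G k.+1) F S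
    = 2 ^ k * k`! * (2 * (k.+1 * \sum_(S in matchings G k.+1) F S)).
  by rewrite expnS factS; lia.
rewrite -sum_matchings_add big_distrr -IH sum_tuple_cons sum_tuple_cons /=.
apply: eq_bigr => t _.
have -> : 2 * \sum_(e in edges G | [disjoint e & cover (pairs t)]) F (e |: pairs t)
    = \sum_(p : G * G | adj p.1 p.2)
        [disjoint [set p.1; p.2] & cover (pairs t)] * F ([set p.1; p.2] |: pairs t).
  by rewrite (sum_edges (fun e => [disjoint e & _] * F (e |: _))) big_mkcondr;
    congr muln; apply: eq_bigr => e _; case: ifP; rewrite ?mul1n.
rewrite exchange_big pair_big big_distrr [RHS]big_mkcond.
apply: eq_bigr => [[x y] _] /=.
rewrite embeds_cons !embeds_shift /= inE negb_or; case: ifP => //= xy.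
have -> : x != y by apply: adj_neq.
rewrite mulnA mulnb; congr (nat_of_bool _ * _).
have tE (z : G) : (z \in cover (pairs t)) = (z \in t) by rewrite cover_pairs.
rewrite andbA [RHS]andbC; congr andb.
by rewrite disjoints_subset subUset !sub1set !inE !tE.
Qed.

Lemma emb_matching (k : nat) :
  emb x0 k.*2 (matching_pattern k) = 2 ^ k * k`! * num_matchings G k.
Proof.
rewrite /num_matchings -sum1_card -(sum_matchings k (fun=> 1)).
by apply: eq_bigr => t _; rewrite muln1.
Qed.

End Matchings.

(** * Subgraphs as labelled copies *)

Definition embeddings (Q G : sgraph) : {set {ffun Q -> G}} :=
  [set f : {ffun Q -> G} |
    injectiveb f && [forall x, forall y, adj x y ==> adj (f x) (f y)]].

Lemma embeddingsP (Q G : sgraph) (f : {ffun Q -> G}) :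
  reflect (injective f /\ forall x y, adj x y -> adj (f x) (f y))
          (f \in embeddings Q G).
Proof.
rewrite inE; apply: (iffP andP) => -[/injectiveP fi fa]; split=> //.
  by move=> x y; have /forallP/(_ y)/implyP := forallP fa x.
by apply/forallP => x; apply/forallP => y; apply/implyP/fa.
Qed.

Definition image_subgraph (Q G : sgraph) (f : Q -> G) : {set G} * {set {set G}} :=
  (f @: [set: Q], [set f @: (a : {set Q}) | a in edges Q]).

Lemma edgeP (G : sgraph) (e : {set G}) :
  reflect (exists x y, adj x y /\ e = [set x; y]) (e \in edges G).
Proof.
apply: (iffP imsetP) => [[[x y]]|[x [y [xy ->]]]].
  by rewrite inE /= => xy ->; exists x, y.
by exists (x, y); rewrite ?inE.
Qed.

Lemma imset_edges (Q : sgraph) (s : {ffun Q -> Q}) : s \in embeddings Q Q ->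
  [set s @: (a : {set Q}) | a in edges Q] = edges Q.
Proof.
case/embeddingsP=> si sa; apply/eqP; rewrite eqEcard; apply/andP; split.
  apply/subsetP => _ /imsetP[a /edgeP[x [y [xy ->]]] ->].
  by rewrite imsetU1 imset_set1 mem_edges sa.
by rewrite (card_imset (edges Q) (imset_inj si)).
Qed.

(** Embeddings with the same image differ by an automorphism of [Q], so all fibres of
    [image_subgraph] have the same size; by finiteness, [embeddings Q Q] consists of
    automorphisms. *)
Lemma num_subgraphs_embeddings (Q G : sgraph) :
  num_subgraphs Q G * #|embeddings Q Q| = #|embeddings Q G|.
Proof.
rewrite -[RHS]sum1_card (partition_big (fun f : {ffun Q -> G} => image_subgraph f)
  (mem [set S : {set G} * {set {set G}} | is_subgraph S && isomorphic_to Q S])) /=;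
  last first.
  move=> f fE; case/embeddingsP: (fE) => fi fa; rewrite inE; apply/andP; split.
    apply/andP; split; last first.
      by apply/forall_inP => _ /imsetP[a _ ->]; apply: imsetS; apply: subsetT.
    apply/subsetP => _ /imsetP[a /edgeP[x [y [xy ->]]] ->].
    by rewrite imsetU1 imset_set1 mem_edges fa.
  by apply/existsP; exists f; rewrite !eqxx !andbT; apply/injectiveP.
rewrite (eq_bigr (fun=> #|embeddings Q Q|)) ?sum_nat_const // => S.
rewrite inE => /andP[/andP[SE _] /existsP[f /and3P[/injectiveP fi /eqP S1 /eqP S2]]].
have fa x y : adj x y -> adj (f x) (f y).
  move=> xy; rewrite -mem_edges; apply: (subsetP SE); rewrite S2.
  by apply/imsetP; exists [set x; y]; rewrite ?mem_edges // imsetU1 imset_set1.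
pose c (s : {ffun Q -> Q}) := [ffun x => f (s x)].
have ci : injective c.
  by move=> s s' /ffunP E; apply/ffunP => x; apply: fi; have := E x; rewrite !ffunE.
rewrite sum1_card -(card_imset _ ci); apply: eq_card => g; rewrite -topredE /=.
apply/andP/imsetP => [[gE /eqP gS]|[s sE ->]]; last first.
  case/embeddingsP: (sE) => si sa; split.
    apply/embeddingsP; split=> [x y|x y xy]; rewrite !ffunE; first by move/fi/si.
    by apply/fa/sa.
  have cE (A : {set Q}) : c s @: A = f @: (s @: A).
    by rewrite -imset_comp; apply: eq_imset => x; rewrite ffunE.
  rewrite [S]surjective_pairing S1 S2 /image_subgraph xpair_eqE; apply/andP; split.
    rewrite cE (_ : s @: setT = setT) //; apply/eqP.
    by rewrite eqEcard subsetT (card_imset _ si) leqnn.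
  apply/eqP; rewrite -{2}(imset_edges sE) -[RHS]imset_comp.
  by apply: eq_imset => a; rewrite cE.
case/embeddingsP: gE => gi ga.
(* As [g] has the same image as [f], the composite of [g] with the inverse of [f] is defined; it is
   the required automorphism. *)
have ex x : exists y, f y == g x.
  have : g x \in S.1 by rewrite -gS imset_f.
  by rewrite S1 => /imsetP[y _ ->]; exists y.
exists [ffun x => xchoose (ex x)]; last first.
  by apply/ffunP => x; rewrite !ffunE; apply/esym/eqP; exact: (xchooseP (ex x)).
have fs x : f (xchoose (ex x)) = g x by apply/eqP; exact: (xchooseP (ex x)).
apply/embeddingsP; split=> [x y|x y xy]; rewrite !ffunE.
  by move/(congr1 f); rewrite !fs => /gi.
have : g @: [set x; y] \in S.2.
  by rewrite -gS /=; apply/imsetP; exists [set x; y]; rewrite ?mem_edges.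
rewrite S2 imsetU1 imset_set1 => /imsetP[_ /edgeP[a [b [ab ->]]]].
rewrite imsetU1 imset_set1.
move: (xchoose (ex x)) (xchoose (ex y)) (fs x) (fs y) => u v <- <-.
by case/set2_eq=> -[/fi -> /fi ->]; rewrite // adj_sym.
Qed.

(** * Copies of Q and its automorphisms *)

Definition Q_vertex (v : graphQ) : nat :=
  match v with inl i => i | inr j => 6 + j end.

Definition Q_index (i : 'I_8) : graphQ := @split 6 2 i.

Lemma Q_indexK (i : 'I_8) : Q_vertex (Q_index i) = i.
Proof. by rewrite -[in RHS](@splitK 6 2 i) /Q_index; case: split. Qed.

Lemma Q_vertex_lt (v : graphQ) : Q_vertex v < 8.
Proof. by case: v => [[i i6]|[j j2]] /=; lia. Qed.

Lemma Q_vertexK (v : graphQ) : Q_index (Ordinal (Q_vertex_lt v)) = v.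
Proof. by rewrite -[RHS](@unsplitK 6 2); congr split; apply: val_inj; case: v. Qed.

Lemma Q_adj (v w : graphQ) : adj v w = padj Q_pattern (Q_vertex v) (Q_vertex w).
Proof.
case: v => [[v hv]|[v hv]]; case: w => [[w hw]|[w hw]] /=;
  do 6? [case: v hv => [|v] hv //]; do 6? [case: w hw => [|w] hw //].
Qed.

Section QCount.
Variables (G : sgraph) (x0 : G).

Definition tuple_of_Q (f : {ffun graphQ -> G}) : 8.-tuple G :=
  [tuple f (Q_index i) | i < 8].

Lemma nth_tuple_of_Q f v : nth x0 (tuple_of_Q f) (Q_vertex v) = f v.
Proof.
by rewrite -[Q_vertex v]/(val (Ordinal (Q_vertex_lt v))) -tnth_nth tnth_mktuple
  Q_vertexK.
Qed.

Lemma card_embeddings_Q : #|embeddings graphQ G| = emb x0 8 Q_pattern.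
Proof.
rewrite -sum1_card big_mkcond /emb (reindex tuple_of_Q) /=; last first.
  exists (fun t => [ffun v => tnth t (Ordinal (Q_vertex_lt v))]) => [f|t] _.
    by apply/ffunP => v; rewrite ffunE tnth_mktuple Q_vertexK.
  apply: eq_from_tnth => i; rewrite tnth_mktuple ffunE; congr tnth.
  by apply: val_inj; rewrite /= Q_indexK.
apply: eq_bigr => f _; rewrite -[LHS]/(nat_of_bool (f \in embeddings graphQ G)).
congr nat_of_bool; apply/(@embeddingsP graphQ G)/idP => [[fi fa]|fE].
  apply/andP; split; first by apply/(tuple_uniqP (tuple_of_Q f)) => i j; rewrite !tnth_mktuple
    => /fi /(congr1 Q_vertex); rewrite !Q_indexK => /val_inj.
  apply/allP => -[a b] abQ /=.
  have /andP[a8 b8] : (a < 8) && (b < 8) by move: abQ; rewrite !inE; do 5?case/orP;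
    move=> /eqP[-> ->].
  have := fa (Q_index (Ordinal a8)) (Q_index (Ordinal b8)).
  by rewrite Q_adj -!nth_tuple_of_Q !Q_indexK /padj /= abQ; apply.
split=> [v w|v w vw]; last first.
  by rewrite -!nth_tuple_of_Q; apply: embeds_padj fE _; rewrite -Q_adj.
case/andP: fE => ut _; rewrite -!nth_tuple_of_Q => /eqP.
rewrite nth_uniq ?size_tuple ?Q_vertex_lt // => /eqP E.
by rewrite -[v]Q_vertexK -[w]Q_vertexK; congr Q_index; apply: val_inj.
Qed.
End QCount.

(** Injective walks in Q, grown one vertex at a time so that the computation meets few lists instead
    of all 8-tuples. *)
Fixpoint Q_walks (k : nat) : seq (seq nat) :=
  if k is k'.+1 then
    let ss := Q_walks k' in
    [seq s <- [seq v :: s | v <- iota 0 8, s <- ss]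
    | uniq s && sorted (padj Q_pattern) s]
  else [:: [::]].

Lemma Q_walksS k :
  Q_walks k.+1 = [seq s <- [seq v :: s | v <- iota 0 8, s <- Q_walks k]
                 | uniq s && sorted (padj Q_pattern) s].
Proof. by []. Qed.

Lemma mem_Q_walks (s : seq nat) :
  all (fun v => v < 8) s -> uniq s -> sorted (padj Q_pattern) s ->
  s \in Q_walks (size s).
Proof.
elim: s => // v s IH sv us ps; rewrite Q_walksS mem_filter us ps !andTb.
apply/allpairsP; exists (v, s); case/andP: sv => v8 s8; case/andP: us => _ us.
split=> //; first by rewrite mem_iota.
by apply: IH => //; apply: path_sorted ps.
Qed.

(** The path may be reversed and the ends of the single edge exchanged, independently. *)
Definition Q_autos : seq (seq nat) :=
  [seq s ++ s' | s <- [:: [:: 0; 1; 2; 3; 4; 5]; [:: 5; 4; 3; 2; 1; 0]],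
                 s' <- [:: [:: 6; 7]; [:: 7; 6]]].

Lemma Q_autosE :
  [seq t <- [seq s ++ s' | s <- Q_walks 6, s' <- Q_walks 2] | uniq t] = Q_autos.
Proof. vm_compute. reflexivity. Qed.

Lemma Q_autosP (t : seq nat) :
  (t \in Q_autos) =
  [&& size t == 8, all (fun v => v < 8) t, uniq t
    & all (fun e => padj Q_pattern (nth 0 t e.1) (nth 0 t e.2)) Q_pattern].
Proof.
apply/idP/idP => [tQ|].
  by move: t tQ; apply/allP.
case: t => [|a0 [|a1 [|a2 [|a3 [|a4 [|a5 [|a6 [|a7 [|a8 t]]]]]]]]] //.
set p := [:: a0; a1; a2; a3; a4; a5]; set q := [:: a6; a7].
rewrite -[_ :: _]/(p ++ q) all_cat cat_uniq.
case/and4P=> _ /andP[p8 q8] /and3P[up pq uq] ad.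
have pW : p \in Q_walks 6.
  by apply: (mem_Q_walks p8 up); case/and5P: ad => /= -> -> -> -> /andP[-> _].
have qW : q \in Q_walks 2.
  by apply: (mem_Q_walks q8 uq); case/and5P: ad => /= _ _ _ _ /and3P[_ -> _].
move: (Q_walks 6) (Q_walks 2) Q_autosE pW qW => W W' <- pW qW.
rewrite mem_filter cat_uniq up pq uq !andTb.
by apply/allpairsP; exists (p, q).
Qed.

Lemma card_aut_Q : #|embeddings graphQ graphQ| = 4.
Proof.
pose x0 : graphQ := Q_index ord0; rewrite (card_embeddings_Q x0) /emb.
have vinj : injective Q_vertex.
  by move=> v w E; rewrite -[v]Q_vertexK -[w]Q_vertexK; congr Q_index; apply: val_inj.
have embE (t : 8.-tuple graphQ) :
    embeds x0 Q_pattern t = (map Q_vertex t \in Q_autos).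
  rewrite Q_autosP size_map size_tuple map_inj_uniq // all_map.
  rewrite (_ : all _ t = true); last by apply/allP => v _; exact: Q_vertex_lt.
  rewrite /embeds; congr andb; apply: eq_in_all => -[a b] abQ.
  have /andP[a8 b8] : (a < 8) && (b < 8) by move: abQ; rewrite !inE; do 5?case/orP;
    move=> /eqP[-> ->].
  by apply: etrans (Q_adj _ _) _; rewrite /= !(nth_map x0) ?size_tuple.
under eq_bigr do rewrite embE.
rewrite -big_mkcond sum1_card cardE -(size_map (fun t => map Q_vertex (val t))).
rewrite (@perm_size _ _ Q_autos) //; apply: uniq_perm => //.
  rewrite map_inj_uniq ?enum_uniq // => t t' /inj_map E.
  by apply: val_inj; exact: E.
move=> s; apply/mapP/idP => [[t]|sQ]; first by rewrite mem_enum => tQ ->.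
have := sQ; rewrite Q_autosP => /and4P[/eqP s8 /allP sv _ _].
have sz : size [seq Q_index (inord v) | v <- s] == 8 by rewrite size_map s8.
have E : map Q_vertex (Tuple sz) = s.
  rewrite /= -map_comp -[RHS]map_id; apply/eq_in_map => v /sv v8 /=.
  by rewrite Q_indexK inordK.
exists (Tuple sz); last by rewrite E.
by rewrite mem_enum; move: sQ; rewrite -{1}E.
Qed.

Lemma emb_Q (G : sgraph) (x0 : G) :
  emb x0 8 Q_pattern = 4 * num_subgraphs graphQ G.
Proof. by rewrite -card_embeddings_Q -num_subgraphs_embeddings card_aut_Q mulnC. Qed.

(** * Cycles and cuts over the field with two elements *)

Section LinearAlgebra.
Local Open Scope ring_scope.

(** The row space of [A] lies in the left kernel of [B^T], whose dimension [e - \rank B] is at most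
    [\rank A]; so the two coincide. *)
Lemma sub_rowspace_of_orthogonal (F : fieldType) (p q e : nat)
    (A : 'M[F]_(p, e)) (B : 'M[F]_(q, e)) (u : 'rV[F]_e) :
  A *m B^T = 0 -> (e <= \rank A + \rank B)%N -> u *m B^T = 0 -> (u <= A)%MS.
Proof.
move=> AB0 rk uB0; have sub : (A <= kermx B^T)%MS by apply/sub_kermxP.
have : (A == kermx B^T)%MS.
  by rewrite -(geq_leqif (mxrank_leqif_eq sub)) mxrank_ker mxrank_tr leq_subLR addnC.
by move/andP=> [_ kA]; apply: submx_trans kA; apply/sub_kermxP.
Qed.

Lemma leq_rank_const_ker (F : fieldType) (p q : nat) (M : 'M[F]_(p, q)) :
  (forall u : 'rV[F]_p, u *m M = 0 -> forall i j, u 0 i = u 0 j) ->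
  (p <= (\rank M).+1)%N.
Proof.
move=> kerM; have : (\rank (kermx M) <= 1)%N.
  suff : (kermx M <= (const_mx 1 : 'rV_p))%MS.
    by move/mxrankS=> h; apply: leq_trans h (rank_leq_row _).
  apply/row_subP => i; apply/submxP.
  (* A row of the kernel is constant, so any entry serves as the scalar; the i-th one exists because
     the kernel matrix is square. *)
  exists (row i (kermx M) 0 i)%:M; apply/rowP => j.
  rewrite mul_scalar_mx !mxE mulr1.
  have := kerM (row i (kermx M)); rewrite -row_mul mulmx_ker row0.
  by move/(_ erefl j i); rewrite !mxE.
by rewrite mxrank_ker leq_subLR addn1.
Qed.

Lemma F2_addNeq0 (a b : 'F_2) : (a + b != 0) = (a != 0) (+) (b != 0).
Proof. by case: a => -[|[|?]] // ?; case: b => -[|[|?]] // ?. Qed.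

Lemma F2_natr_neq0 (n : nat) : (n%:R != 0 :> 'F_2) = odd n.
Proof.
by rewrite -(dvdn_pcharf (pchar_Fp (isT : prime 2))) dvdn2 negbK.
Qed.

Lemma F2_add_eq0 (a b : 'F_2) : a + b = 0 -> a = b.
Proof. by move/eqP; rewrite addr_eq0 => /eqP ->; case: b => -[|[|?]] // ?; apply: val_inj. Qed.

End LinearAlgebra.

(** * Incidence matrices of a plane graph *)

Section Homology.
Variable G : plane_graph.
Local Notation face := (porbit (face_perm (Defs.rot G))).
Implicit Types (d : dart G).

Definition dart_head d : G := (val d).2.
Definition dart_edge d : {set G} := [set tail d; dart_head d].

Lemma adj_dart d : adj (tail d) (dart_head d).
Proof. exact: (valP d). Qed.

Lemma dart_edgeE d d' :
  (dart_edge d == dart_edge d') = (d' == d) || (d' == rev_dart d).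
Proof.
apply/eqP/orP => [/set2_eq|[]/eqP ->]; last by rewrite /dart_edge setUC.
  case: d d' => [[x y] p] [[x' y'] p']; rewrite /tail /dart_head /= => -[] [ex ey].
    by left; apply/eqP/val_inj; rewrite /= ex ey.
  by right; apply/eqP/val_inj; rewrite /= ex ey.
by [].
Qed.

Lemma rev_dart_neq d : rev_dart d != d.
Proof.
apply: contraTneq (adj_dart d) => /(congr1 (@tail G)) E.
by rewrite -E /tail /dart_head /= adj_irrefl.
Qed.

Lemma face_next d : face (face_perm (Defs.rot G) d) = face d.
Proof.
by rewrite -(porbit_perm (face_perm (Defs.rot G)) 1 d) expg1.
Qed.

Lemma tail_face_perm d : tail (face_perm (Defs.rot G) d) = dart_head d.
Proof.
rewrite /face_perm permM permE.
have : Defs.rot G (rev_dart d) \in porbit (Defs.rot G) (rev_dart d).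
  by rewrite -{1}[Defs.rot G]expg1 mem_porbit.
by rewrite rotP inE => /eqP.
Qed.

Local Open Scope ring_scope.

Definition incidence : 'M['F_2]_(#|G|, #|edges G|) :=
  \matrix_(v < #|G|, e < #|edges G|)
    ((enum_val v : G) \in (enum_val e : {set G}))%:R.

(** Darts are counted modulo 2, so an edge with the same face on both sides gets the entry 0. *)
Definition face_incidence : 'M['F_2]_(#|faces G|, #|edges G|) :=
  \matrix_(f < #|faces G|, e < #|edges G|)
    \sum_(d in (enum_val f : {set dart G}) | dart_edge d == enum_val e) 1.

Lemma edge_of_dart d : dart_edge d \in edges G.
Proof. by rewrite mem_edges adj_dart. Qed.

Lemma face_of_dart d : face d \in faces G.
Proof. exact: imset_f. Qed.

Definition edge_rank d : 'I_#|edges G| := enum_rank_in (edge_of_dart d) (dart_edge d).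
Definition face_rank d : 'I_#|faces G| := enum_rank_in (face_of_dart d) (face d).

Lemma edge_rankK d : enum_val (edge_rank d) = dart_edge d.
Proof. by rewrite enum_rankK_in // edge_of_dart. Qed.

Lemma face_rankK d : enum_val (face_rank d) = face d.
Proof. by rewrite enum_rankK_in // face_of_dart. Qed.

Lemma face_rank_ex (f : 'I_#|faces G|) : exists d, f = face_rank d.
Proof.
have /imsetP[d _ E] := enum_valP f.
by exists d; apply: enum_val_inj; rewrite face_rankK.
Qed.

Lemma mem_enum_face (f : 'I_#|faces G|) d :
  (d \in (enum_val f : {set dart G})) = (f == face_rank d).
Proof.
have [d' ->] := face_rank_ex f; rewrite face_rankK.
by rewrite -(inj_eq enum_val_inj) !face_rankK eq_porbit_mem porbit_sym.
Qed.

Lemma sum_face_incidence (s : 'rV['F_2]_#|faces G|) d :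
  (s *m face_incidence) 0 (edge_rank d) =
  s 0 (face_rank d) + s 0 (face_rank (rev_dart d)).
Proof.
rewrite mxE; under eq_bigr do rewrite mxE mulr_sumr edge_rankK.
rewrite (exchange_big_dep (fun d' => (d' == d) || (d' == rev_dart d))) /=; last first.
  by move=> f d' _ /andP[_]; rewrite eq_sym dart_edgeE.
have h d' : (d' == d) || (d' == rev_dart d) ->
    \sum_(f < #|faces G| | (d' \in (enum_val f : {set dart G}))
                          && (dart_edge d' == dart_edge d)) s 0 f * 1
    = s 0 (face_rank d').
  move=> dd'; rewrite (big_pred1 (face_rank d')) ?mulr1 // => f.
  by rewrite mem_enum_face [dart_edge _ == _]eq_sym dart_edgeE dd' andbT.
rewrite (eq_bigr _ h) (bigD1 d) ?eqxx //=; congr (_ + _).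
rewrite (big_pred1 (rev_dart d)) // => d'.
by case: eqVneq => [->|] /=; rewrite ?andbT // [d == _]eq_sym (negPf (rev_dart_neq d)).
Qed.

Lemma incidence_mul (u : 'rV['F_2]_#|G|) d :
  (u *m incidence) 0 (edge_rank d) =
  u 0 (enum_rank (tail d)) + u 0 (enum_rank (dart_head d)).
Proof.
rewrite mxE; under eq_bigr do rewrite mxE edge_rankK !inE.
have th : tail d != dart_head d by apply/adj_neq/adj_dart.
rewrite (bigD1 (enum_rank (tail d))) //= enum_rankK eqxx mulr1; congr (_ + _).
rewrite (bigD1 (enum_rank (dart_head d))) /= ?enum_rankK ?eqxx ?orbT ?mulr1; last first.
  by rewrite (inj_eq enum_rank_inj) eq_sym.
rewrite big1 ?addr0 // => v /andP[vt vh].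
rewrite -[tail d]enum_rankK -[dart_head d]enum_rankK !(inj_eq enum_val_inj).
by rewrite (negPf vt) (negPf vh) mulr0.
Qed.

(** At every vertex a face has as many incoming as outgoing darts, [face_perm] pairing them, so the
    sum is even. *)
Lemma face_incidence_orthogonal : face_incidence *m incidence^T = 0.
Proof.
apply/matrixP => f v; rewrite !mxE; set x := enum_val v.
under eq_bigr do rewrite !mxE mulr_suml.
rewrite (exchange_big_dep (mem (enum_val f : {set dart G}))) /=;
  last by move=> e d _ /andP[].
have h d : d \in (enum_val f : {set dart G}) ->
    \sum_(e < #|edges G| |
        (d \in (enum_val f : {set dart G})) && (dart_edge d == enum_val e))
       1 * (x \in (enum_val e : {set G}))%:R
    = (tail d == x)%:R + (dart_head d == x)%:R :> 'F_2.
  move=> df; rewrite (big_pred1 (edge_rank d)) => [|e]; last first.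
    by rewrite df -edge_rankK (inj_eq enum_val_inj) eq_sym.
  have th : tail d != dart_head d by apply/adj_neq/adj_dart.
  rewrite mul1r edge_rankK !inE ![x == _]eq_sym; case: (eqVneq _ x) th => [->|] /=.
    by rewrite eq_sym => /negPf ->; rewrite addr0.
  by rewrite add0r.
rewrite (eq_bigr _ h) big_split /=.
rewrite [X in X + _](reindex_inj (@perm_inj _ (face_perm (Defs.rot G)))) /=.
under eq_bigr do rewrite tail_face_perm.
rewrite (eq_bigl (mem (enum_val f : {set dart G}))) => [|d]; last first.
  have [d' ->] := face_rank_ex f; rewrite face_rankK /=.
  by rewrite -!eq_porbit_mem face_next.
rewrite -mulr2n; apply/eqP; rewrite -mulr_natl.
by rewrite (_ : 2%:R = 0 :> 'F_2) ?mul0r //; apply: val_inj.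
Qed.

Lemma connected_const (T : Type) (u : G -> T) :
  (forall x y, adj x y -> u x = u y) -> forall x y, u x = u y.
Proof.
move=> uadj x y; have /connectP[p + ->] := plane_connected x y.
by elim: p x => //= z p IH x /andP[/uadj -> /IH].
Qed.

(** Both left kernels consist of constants, so the ranks are at least |V| - 1 and |F| - 1, which add
    up to |E| by Euler's formula. *)
Lemma incidence_rank : (#|edges G| <= \rank face_incidence + \rank incidence)%N.
Proof.
have rB : (#|G| <= (\rank incidence).+1)%N.
  apply: leq_rank_const_ker => u /rowP u0 i j.
  rewrite -[i]enum_valK -[j]enum_valK.
  apply: (@connected_const _ (fun x => u 0 (enum_rank x))) => x y xy.
  pose d : dart G := exist (fun d : G * G => adj d.1 d.2) (x, y) xy.
  by apply: F2_add_eq0; have := u0 (edge_rank d); rewrite incidence_mul mxE.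
have rA : (#|faces G| <= (\rank face_incidence).+1)%N.
  apply: leq_rank_const_ker => s /rowP s0 i j.
  have [di ->] := face_rank_ex i; have [dj ->] := face_rank_ex j.
  (* [g] is constant across edges and along faces, hence around vertices, since the rotation is
     reversal followed by [face_perm]; connectedness does the rest. *)
  pose g d := s 0 (face_rank d).
  have g_rev d : g (rev_dart d) = g d.
    by apply/esym/F2_add_eq0; rewrite /g -sum_face_incidence s0 mxE.
  have g_next d : g (face_perm (Defs.rot G) d) = g d.
    rewrite /g; congr (s 0 _); apply: enum_val_inj.
    by rewrite !face_rankK face_next.
  have g_rot d : g (Defs.rot G d) = g d.
    rewrite -[in RHS]g_rev -[RHS]g_next /face_perm permM permE.
    by congr (g (Defs.rot G _)); case: d => -[x y] xy; apply: val_inj.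
  have g_tail d d' : tail d' = tail d -> g d' = g d.
    move=> E; have : d' \in porbit (Defs.rot G) d by rewrite rotP inE E.
    case/porbitP=> k ->; elim: k => [|k IH]; first by rewrite expg0 perm1.
    by rewrite expgSr permM g_rot.
  (* To apply connectedness, [g] is read off at a chosen dart of each vertex, [None] standing for a
     vertex without darts. *)
  have [dv dvE] : exists dv : G -> option (dart G), forall d, dv (tail d) != None /\
      forall d', dv (tail d) = Some d' -> tail d' = tail d.
    exists (fun x => [pick d | tail d == x]) => d; case: pickP => [d' /eqP E|/(_ d)].
      by split=> // _ [<-].
    by rewrite eqxx.
  have gE d : g d = odflt 0 (omap g (dv (tail d))).
    have [] := dvE d; case: (dv _) => // d' _ /(_ _ erefl) E; exact/esym/g_tail.
  rewrite -/(g di) -/(g dj) !gE.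
  apply: (@connected_const _ (fun x => odflt 0 (omap g (dv x)))) => x y xy.
  pose d : dart G := exist (fun d : G * G => adj d.1 d.2) (x, y) xy.
  by have := g_rev d; rewrite !gE.
have eul : (#|G| + #|faces G| = #|edges G| + 2)%N := plane_euler G.
by rewrite -(leq_add2r 2) -eul addnC -[2%N]/(1 + 1)%N addnACA leq_add // addn1.
Qed.

Lemma even_faces_bipartite : (forall f, f \in faces G -> ~~ odd #|f|) ->
  exists u : G -> bool, forall x y, adj x y -> u x != u y.
Proof.
move=> evenG.
(* Pairing the all-one vector with a face gives the length of the face modulo 2. The potential [D]
   is the colouring. *)
have [D /rowP DE] : exists D, (const_mx 1 : 'rV['F_2]_#|edges G|) = D *m incidence.
  apply/submxP; apply: (@sub_rowspace_of_orthogonal _ _ _ _ _ face_incidence).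
  - by rewrite -[LHS]trmxK trmx_mul trmxK face_incidence_orthogonal trmx0.
  - by rewrite addnC incidence_rank.
  apply/rowP => f; rewrite !mxE; under eq_bigr do rewrite !mxE mul1r.
  rewrite (exchange_big_dep (mem (enum_val f : {set dart G}))) /=;
  last by move=> e d _ /andP[].
  under eq_bigr => d df.
    rewrite (big_pred1 (edge_rank d)) => [|e]; last first.
      by rewrite df -edge_rankK (inj_eq enum_val_inj) eq_sym.
    over.
  rewrite sumr_const; apply/eqP; rewrite -[_ == _]negbK F2_natr_neq0.
  exact/evenG/enum_valP.
exists (fun x => D 0 (enum_rank x) != 0) => x y xy.
pose d : dart G := exist (fun d : G * G => adj d.1 d.2) (x, y) xy.
have := DE (edge_rank d); rewrite incidence_mul mxE => E.
by rewrite negb_eqb -F2_addNeq0 -E.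
Qed.

(** Even degree at each vertex means orthogonality to the rows of [incidence], so [C] is a sum of
    faces; [S] collects the faces that occur in it. *)
Lemma even_set_boundary (C : {set {set G}}) :
  (forall x, ~~ odd #|[set y | adj x y && ([set x; y] \in C)]|) ->
  exists S : {set {set dart G}}, forall d,
    (dart_edge d \in C) = (face d \in S) (+) (face (rev_dart d) \in S).
Proof.
move=> evenC; pose c : 'rV['F_2]_#|edges G| := \row_e ((enum_val e : {set G}) \in C)%:R.
have [D /rowP DE] : exists D, c = D *m face_incidence.
  apply/submxP; apply: (sub_rowspace_of_orthogonal face_incidence_orthogonal).
    exact: incidence_rank.
  apply/rowP => v; rewrite !mxE; set x := enum_val v.
  apply/eqP; rewrite -[_ == _]negbK; apply: contra (evenC x).
  rewrite -F2_natr_neq0; congr (_ != _).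
  under eq_bigr do rewrite !mxE -natrM mulnb.
  rewrite -natr_sum; congr (_%:R).
  rewrite -(big_enum_val (fun e : {set G} => ((e \in C) && (x \in e) : nat))).
  have inj2 : injective (fun y : G => [set x; y]).
    by move=> y y' /set2_eq[[]|[-> ->]].
  rewrite -(card_imset _ inj2) -sum1_card big_mkcond [RHS]big_mkcond /=.
  apply: eq_bigr => e _.
  suff -> : (e \in [set [set x; y] | y in [set y | adj x y && ([set x; y] \in C)]])
      = [&& e \in edges G, e \in C & x \in e] by case: (e \in edges G) => //=; case: (_ && _).
  apply/imsetP/and3P => [[y]|[/edgeP[a [b [ab ->]]] eC]].
    by rewrite inE => /andP[xy xyC] ->; rewrite mem_edges set21.
  rewrite !inE => /orP[]/eqP E; first by exists b; rewrite ?inE E ?ab ?eC.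
  by exists a; rewrite ?inE E setUC // adj_sym ab.
exists [set f in faces G | [exists i, (enum_val i == f) && (D 0 i != 0)]] => d.
have fD d' : (face d' \in
      [set f in faces G | [exists i, (enum_val i == f) && (D 0 i != 0)]])
    = (D 0 (face_rank d') != 0).
  rewrite inE face_of_dart; apply/existsP/idP => [[i /andP[/eqP E]]|D0].
    by rewrite -face_rankK in E; rewrite (enum_val_inj E).
  by exists (face_rank d'); rewrite face_rankK eqxx.
rewrite !fD -F2_addNeq0 -sum_face_incidence -DE mxE edge_rankK.
by case: (_ \in _).
Qed.

End Homology.

(** * Four-cycles *)

Section FourCycles.
Variables (G : sgraph) (T : finType) (next : G -> G -> G) (face : G -> G -> T).
Implicit Types (x y : G) (S : {set T}).

(** This is [face_perm], with darts written as pairs of vertices. *)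
Definition face_step (p : G * G) : G * G := (p.2, next p.2 p.1).

(* [next x y] is the neighbour of [x] that follows [y] around [x], and
   [face x y] is the face on the side of the dart [(x, y)]. *)
Record face_system : Prop := {
  adj_next : forall x y, adj x y -> adj x (next x y);
  next3 : forall x y, adj x y -> next x (next x (next x y)) = y;
  next_neq : forall x y, adj x y -> next x y != y;
  next_cover : forall x y z, adj x y -> adj x z ->
    [|| z == y, z == next x y | z == next x (next x y)];
  face_stepE : forall x y, adj x y -> face y (next y x) = face x y;
  face_inj : forall x y z, adj x y -> adj x z -> face x y = face x z -> y = z;
  face_close : forall x y, adj x y ->
    iter 4 face_step (x, y) = (x, y) \/ iter 6 face_step (x, y) = (x, y);
  face_mem : forall x y u v, adj x y -> adj u v -> face u v = face x y ->
    (u, v) \in traject face_step (x, y) 6;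
  face_colour : exists c : G -> bool, forall x y, adj x y -> c x != c y }.

Hypothesis FS : face_system.

Lemma next_inj x y z : adj x y -> adj x z -> next x y = next x z -> y = z.
Proof. by move=> xy xz E; rewrite -(next3 FS xy) -(next3 FS xz) E. Qed.

Lemma next2_neq x y : adj x y -> next x (next x y) != y.
Proof.
move=> xy; apply: contraTneq (next_neq FS xy) => E.
by have := next3 FS xy; rewrite negbK E => ->.
Qed.

Lemma next_other x y z : adj x y -> adj x z -> y != z -> next x y != z ->
  next x (next x y) = z /\ next x z = y.
Proof.
move=> xy xz nyz nz; have := next_cover FS xy xz.
rewrite eq_sym (negPf nyz) eq_sym (negPf nz) /= => /eqP E.
by rewrite E (next3 FS xy).
Qed.

Definition cycle_darts (a b c d : G) : seq (G * G) :=
  [:: (a, b); (b, c); (c, d); (d, a)].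

Definition four_cycle (a b c d : G) : Prop :=
  [/\ adj a b, adj b c, adj c d, adj d a & (a != c) /\ (b != d)].

(* S is a set of faces whose boundary is the cycle, lying to the left of it. *)
Definition bounds S (a b c d : G) : Prop :=
  [/\ forall x y, (x, y) \in cycle_darts a b c d -> face x y \in S,
      forall x y, (x, y) \in cycle_darts a b c d -> face y x \notin S
    & forall x y, adj x y -> face x y \in S ->
        (x, y) \in cycle_darts a b c d \/ face y x \in S].

Lemma cycle_darts_ind (P : G -> G -> Prop) a b c d :
  P a b -> P b c -> P c d -> P d a ->
  forall x y, (x, y) \in cycle_darts a b c d -> P x y.
Proof. by move=> ? ? ? ? x y; rewrite !inE => /or4P[]/eqP[-> ->]. Qed.

Lemma four_cycle_rot a b c d : four_cycle a b c d -> four_cycle b c d a.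
Proof. by case=> ? ? ? ? [? ?]; split=> //; split=> //; rewrite eq_sym. Qed.

Lemma cycle_darts_rot a b c d : cycle_darts b c d a =i cycle_darts a b c d.
Proof.
move=> p; rewrite !inE.
by case: (p == (a, b)); case: (p == (b, c)); case: (p == (c, d)); case: (p == _).
Qed.

Lemma bounds_rot S a b c d : bounds S a b c d -> bounds S b c d a.
Proof.
by case=> h1 h2 h3; split=> x y; rewrite cycle_darts_rot; [apply: h1|apply: h2|apply: h3].
Qed.

Lemma face6_mem a0 a1 a2 a3 a4 a5 u v : adj a0 a1 ->
  next a1 a0 = a2 -> next a2 a1 = a3 -> next a3 a2 = a4 -> next a4 a3 = a5 ->
  next a5 a4 = a0 -> adj u v -> face u v = face a0 a1 ->
  (u, v) \in [:: (a0, a1); (a1, a2); (a2, a3); (a3, a4); (a4, a5); (a5, a0)].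
Proof.
move=> a01 e1 e2 e3 e4 e5 uv /(face_mem FS a01 uv).
by rewrite /= /face_step /= e1 e2 e3 e4 e5.
Qed.

(* The face of (b, c) is a hexagon sharing three edges with the cycle.  Removing
   it from S leaves a set bounded by the 4-cycle on its other three edges and ab,
   with turns of the same kind. *)
Lemma no_adjacent_turns n S a b c d : #|S| < n -> four_cycle a b c d ->
  bounds S a b c d -> next a d != b -> next b a != c -> next c b = d ->
  next d c = a -> False.
Proof.
elim: n S a b c d => // n IH S a b c d Sn [ab bc cd da [ac bd]] [S1 S2 S3].
have [ba cb dc ad] : [/\ adj b a, adj c b, adj d c & adj a d].
  by split; rewrite adj_sym.
have db : d != b by rewrite eq_sym.
move=> ta tb tc td.
have [ta1 ta2] := next_other ad ab db ta.
have [tb1 tb2] := next_other ba bc ac tb.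
move: (adj_next FS ad) (adj_next FS ba) (next_neq FS ad) (next_neq FS ba).
set a' := next a d in ta ta1 *; set b' := next b a in tb tb1 *.
move=> aa' bb' a'd b'a.
have [a'a b'b] : adj a' a /\ adj b' b by split; rewrite adj_sym.
(* Closing after four steps would give [a' = b], against the turn at [a]. So the face is a hexagon,
   and its remaining vertex turns out to be [b']. *)
have := face_close FS bc; rewrite /= /face_step /= tc td -/a'.
case=> [[E _]|[E1 E2]]; first by rewrite E eqxx in ta.
have yb' : next a' a = b'.
  have a'y := adj_next FS a'a; have ya' : adj (next a' a) a' by rewrite adj_sym.
  have := adj_next FS ya'; rewrite E1 adj_sym => yb.
  by apply: (next_inj yb bb'); rewrite -{1}E1 E2 tb1.
rewrite yb' in E1 E2 *; rewrite E1 in E2.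
have [col colP] := face_colour FS.
have col2 x y z : adj x y -> adj y z -> col x = col z.
  by move=> /colP + /colP; case: (col x); case: (col y); case: (col z).
have a'b' : adj a' b' by rewrite -yb'; apply: adj_next.
(* [a'] and [c] have opposite colours, and so have [b'] and [d]. *)
have a'c : a' != c.
  by apply: contraTneq (colP _ _ aa') => ->; rewrite (col2 _ _ _ ab bc) eqxx.
have b'd : b' != d.
  by apply: contraTneq (colP _ _ bb') => ->; rewrite (col2 _ _ _ bc cd) eqxx.
have [naa nbb] := (adj_neq a'a, adj_neq b'b).
pose f := face b c.
have f2 : face c d = f by rewrite -tc (face_stepE FS bc).
have f3 : face d a = f by rewrite -td (face_stepE FS cd).
have f4 : face a a' = f by rewrite (face_stepE FS da).
have f5 : face a' b' = f by rewrite -yb' (face_stepE FS aa').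
have f6 : face b' b = f by rewrite -E1 (face_stepE FS a'b').
have fS : f \in S by apply: S1; rewrite !inE eqxx orbT.
apply: (IH (S :\ f) b' a' a b) => //.
- by move: Sn; rewrite (cardsD1 f S) fS.
- by split; rewrite // adj_sym.
- split=> [x y|x y|x y xy].
  + rewrite !inE => /or4P[]/eqP[-> ->]; apply/andP; split.
    * rewrite -f6; apply/eqP => /(face_inj FS) E; move: ta; rewrite E ?eqxx //.
      by rewrite adj_sym.
    * by have := S3 _ _ a'b'; rewrite f5 !inE !xpair_eqE; case=> //;
        rewrite (negPf naa) (negPf ta) (negPf a'c) (negPf a'd).
    * rewrite -f5; apply/eqP => /(face_inj FS) E; move: b'a; rewrite -E ?eqxx //.
    * by have := S3 _ _ aa'; rewrite f4 !inE !xpair_eqE; case=> //;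
        rewrite (negPf ta) (negPf a'c) (negPf a'd) (negPf naa) ?andbF.
    * by rewrite -f4; apply/eqP => /(face_inj FS) E; move: ta; rewrite -E ?eqxx.
    * by apply: S1; rewrite !inE eqxx.
    * by apply/eqP => /(face_inj FS) E; move: tb; rewrite E ?eqxx.
    * by have := S3 _ _ b'b; rewrite f6 !inE !xpair_eqE; case=> //;
        rewrite (negPf nbb) (negPf b'a) (negPf tb) (negPf b'd).
  + rewrite !inE => /or4P[]/eqP[-> ->]; rewrite ?f5 ?f4 ?f6 ?eqxx //=.
    by rewrite (negPf (S2 _ _ _)) ?andbF // !inE eqxx.
  + rewrite in_setD1 => /andP[xyf xyS].
    have [] := S3 _ _ xy xyS => [|yxS].
      rewrite !inE => /or4P[]/eqP E; move: xyf; case: E => -> ->;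
        rewrite ?f2 ?f3 ?eqxx //.
      by left; rewrite !orbT.
    (* If the reverse dart is on the removed hexagon, then (x, y) is on the new cycle, or it is the
       reverse of a dart of the old cycle and its face is outside [S]. *)
    case: (eqVneq (face y x) f) => [E|yxf]; last by right; rewrite in_setD1 yxf.
    have yx : adj y x by rewrite adj_sym.
    have := face6_mem bc tc td erefl yb' E1 yx E; rewrite -/a'.
    have S2' u v : (u, v) \in cycle_darts a b c d -> face v u \in S -> False.
      by move/S2/negP.
    by rewrite !inE; do 5? case/orP; case/eqP=> ey ex; subst x y;
      try (by left; rewrite ?eqxx ?orbT);
      case: (S2' _ _ _ xyS); rewrite !inE eqxx ?orbT.
- by apply: contraTneq (next2_neq (_ : adj b' a')) => [E|]; rewrite ?E1 ?E ?eqxx // adj_sym.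
- by apply: contraTneq (next2_neq a'a) => E; rewrite yb' E eqxx.
Qed.

(** The face of (a, b) passes through [c], leaves the cycle there towards [next c b] and re-enters
    it at [a] from [next a d]. It closes as a square if these two vertices coincide, and as a
    hexagon otherwise. *)
Lemma opposite_face a b c d : four_cycle a b c d ->
  next a d != b -> next b a = c -> next c b != d ->
  (next a d = next c b /\ next (next c b) c = a) \/
  (next (next (next c b) c) (next c b) = next a d /\
   next (next a d) (next (next c b) c) = a).
Proof.
move=> [ab bc cd da [ac bd]] ta tb tc.
set a' := next a d; set c' := next c b; set y := next c' c.
have [ba cb dc ad] : [/\ adj b a, adj c b, adj d c & adj a d].
  by split; rewrite adj_sym.
have db : d != b by rewrite eq_sym.
have [ta1 ta2] := next_other ad ab db ta; rewrite -/a' in ta1.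
have aa' : adj a a' by apply: adj_next.
have cc' : adj c c' by apply: adj_next.
have c'y : adj c' y by apply: adj_next => //; rewrite adj_sym.
have := face_close FS ab; rewrite /= /face_step /= tb -/c' -/y.
case=> [[E1 E2]|[E1 E2]]; [left|right].
  split=> //; have ac' : adj a c' by rewrite adj_sym -E1.
  by apply: (next_inj aa' ac'); rewrite ta1 -{1}E1 E2.
have yw : adj y (next y c') by apply: (adj_next FS); rewrite adj_sym.
have aw : adj a (next y c').
  by rewrite adj_sym -E1; apply: (adj_next FS); rewrite adj_sym.
suff wa' : next y c' = a' by split=> //; rewrite -wa'.
by apply: (next_inj aw aa'); rewrite ta1 -{1}E1 E2.
Qed.

(* Here the faces of (a, b) and (c, d) are hexagons, and removing both leaves a
   set bounded by another 4-cycle with opposite turns. *)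
Lemma no_opposite_turns n S a b c d : #|S| < n -> four_cycle a b c d ->
  bounds S a b c d -> next a d != b -> next b a = c -> next c b != d ->
  next d c = a -> False.
Proof.
elim: n S a b c d => // n IH S a b c d Sn Cy Bd ta tb tc td.
have Cy' := four_cycle_rot (four_cycle_rot Cy).
have F1 := opposite_face Cy ta tb tc; have F2 := opposite_face Cy' tc td ta.
case: Cy Bd {Cy'} => [ab bc cd da [ac bd]] [S1 S2 S3].
have [ba cb dc ad] : [/\ adj b a, adj c b, adj d c & adj a d].
  by split; rewrite adj_sym.
have db : d != b by rewrite eq_sym.
have [ta1 ta2] := next_other ad ab db ta.
have [tc1 tc2] := next_other cb cd bd tc.
move: (adj_next FS ad) (adj_next FS cb) (next_neq FS ad) (next_neq FS cb).
set a' := next a d in F1 F2 ta ta1 *; set c' := next c b in F1 F2 tc tc1 *.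
move=> aa' cc' a'd c'b.
have a'a : adj a' a by rewrite adj_sym.
have c'c : adj c' c by rewrite adj_sym.
move: F1 F2 (adj_next FS c'c) (adj_next FS a'a) (next_neq FS c'c) (next_neq FS a'a).
set y := next c' c; set z := next a' a => F1 F2 c'y a'z yc za.
have [yc' za'] : adj y c' /\ adj z a' by split; rewrite adj_sym.
(* Both faces are hexagons: a square would give [a' = c'], and then either form of the other face
   makes [next] return to its argument after one or two steps. *)
have [e1 e2] : next y c' = a' /\ next a' y = a.
  case: F1 F2 => // -[ac' ya] [[_ zc]|[zc' _]].
    have := next2_neq a'a; rewrite -/z zc ac' -/y ya eqxx //.
  by have := next_neq FS za'; rewrite zc' ac' eqxx.
have [e3 e4] : next z a' = c' /\ next c' z = c.
  case: F2 => // -[ac' _]; by have := next_neq FS yc'; rewrite e1 -ac' eqxx.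
clear F1 F2.
have a'c' : a' != c' by rewrite -e1; apply: (next_neq FS).
have ya' : adj y a' by rewrite -e1; apply: adj_next.
have zc' : adj z c' by rewrite -e3; apply: adj_next.
have [a'y c'z] : adj a' y /\ adj c' z by split; rewrite adj_sym.
have yz : y != z.
  by apply: contraTneq (next2_neq c'z) => E; rewrite e4 -/y E eqxx.
have ya : y != a by rewrite eq_sym -e2; apply: (next_neq FS).
have zc : z != c by rewrite eq_sym -e4; apply: (next_neq FS).
have [col colP] := face_colour FS.
have col2 (p q r : G) : adj p q -> adj q r -> col p = col r.
  by move=> /colP + /colP; case: (col p); case: (col q); case: (col r).
have a'c : a' != c.
  by apply: contraTneq (colP _ _ aa') => ->; rewrite (col2 _ _ _ ab bc) eqxx.
have c'a : c' != a.
  by apply: contraTneq (colP _ _ cc') => ->; rewrite (col2 _ _ _ ab bc) eqxx.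
have [naa ncc] := (adj_neq a'a, adj_neq c'c).
have notin (u v : G) : (u == a') || (u == c') || (v == a') || (v == c') ->
    (u, v) \notin cycle_darts a b c d.
  rewrite !inE !xpair_eqE -!orbA.
  by case/or4P=> /eqP ->; rewrite ?(negPf naa) ?(negPf ta) ?(negPf a'c) ?(negPf a'd)
    ?(negPf c'a) ?(negPf c'b) ?(negPf ncc) ?(negPf tc) ?andbF.
pose f1 := face a b; pose f2 := face c d.
have f12 : face b c = f1 by rewrite -tb (face_stepE FS ab).
have f13 : face c c' = f1 by rewrite (face_stepE FS bc).
have f14 : face c' y = f1 by rewrite (face_stepE FS cc').
have f15 : face y a' = f1 by rewrite -e1 (face_stepE FS c'y).
have f16 : face a' a = f1 by rewrite -e2 (face_stepE FS ya').
have f22 : face d a = f2 by rewrite -td (face_stepE FS cd).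
have f23 : face a a' = f2 by rewrite (face_stepE FS da).
have f24 : face a' z = f2 by rewrite (face_stepE FS aa').
have f25 : face z c' = f2 by rewrite -e3 (face_stepE FS a'z).
have f26 : face c' c = f2 by rewrite -e4 (face_stepE FS zc').
have m1 (u v : G) : adj u v -> face u v = f1 -> (u, v) \in
    [:: (a, b); (b, c); (c, c'); (c', y); (y, a'); (a', a)].
  by apply: face6_mem.
have m2 (u v : G) : adj u v -> face u v = f2 -> (u, v) \in
    [:: (c, d); (d, a); (a, a'); (a', z); (z, c'); (c', c)].
  by apply: face6_mem.
have f1S : f1 \in S by apply: S1; rewrite !inE eqxx.
have f2S : f2 \in S by apply: S1; rewrite !inE eqxx !orbT.
pose S' := S :\ f1 :\ f2.
(* Edges at [a'] or [c'] are off the old cycle, so [S] contains both of their sides or neither; only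
   the darts of the two hexagons lose their face. *)
have inS' (u v : G) : adj u v -> face v u \in S ->
    (u == a') || (u == c') || (v == a') || (v == c') ->
    (u, v) \notin [:: (a, b); (b, c); (c, c'); (c', y); (y, a'); (a', a)] ->
    (u, v) \notin [:: (c, d); (d, a); (a, a'); (a', z); (z, c'); (c', c)] ->
    face u v \in S'.
  move=> uv vuS nuv n1 n2; rewrite !in_setD1.
  rewrite (contraNneq (m2 _ _ uv) n2) (contraNneq (m1 _ _ uv) n1) /=.
  have vu : adj v u by rewrite adj_sym.
  have vuC : (v, u) \notin cycle_darts a b c d.
    by apply: notin; move: nuv; rewrite -!orbA => /or4P[]/eqP ->; rewrite eqxx ?orbT.
  by case: (S3 _ _ vu vuS) => //; rewrite (negPf vuC).
have neqs := (negPf naa, negPf ncc, negPf a'c, negPf c'a, negPf a'd, negPf c'b,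
  negPf ta, negPf tc, negPf a'c', negPf yz, negPf ya, negPf zc, negPf yc, negPf za).
have neqs' := (eq_sym c' a', eq_sym z y, negPf (adj_neq a'y), negPf (adj_neq ya'),
  negPf (adj_neq c'z), negPf (adj_neq zc'), negPf (adj_neq c'y), negPf (adj_neq yc'),
  negPf (adj_neq a'z), negPf (adj_neq za'), neqs).
apply: (IH S' y c' z a') => //.
- apply: leq_ltn_trans (subset_leq_card (subsetDl _ _)) _.
  by move: Sn; rewrite (cardsD1 f1 S) f1S.
- by split=> //; split=> //; rewrite eq_sym.
- split=> [||u v uv].
  + apply: (cycle_darts_ind (P := fun u v => face u v \in S')); apply: inS' => //;
      rewrite ?eqxx ?orbT // ?f14 ?f15 ?f24 ?f25 //;
      by rewrite !inE !xpair_eqE !neqs' ?andbF ?eqxx.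
  + refine (cycle_darts_ind (P := fun u v => face v u \notin S') _ _ _ _);
      rewrite /S' ?f14 ?f15 ?f24 ?f25 !in_setD1 ?eqxx ?andbF //.
  + rewrite /S' !in_setD1 => /and3P[uv2 uv1 uvS].
    have [] := S3 _ _ uv uvS => [|vuS].
      rewrite !inE => /or4P[]/eqP E; move: uv1 uv2; case: E => -> ->;
        by rewrite ?f12 ?f22 ?eqxx.
    have vu : adj v u by rewrite adj_sym.
    have S2' (p q : G) : (p, q) \in cycle_darts a b c d -> face q p \in S -> False.
      by move/S2/negP.
    case: (eqVneq (face v u) f2) => [/(m2 _ _ vu)|vu2].
      by rewrite !inE; do 5? case/orP; case/eqP=> ev eu; move: uv1 uv2 uvS;
        rewrite ev eu ?f16 ?f13 ?eqxx // => uv1 uv2 uvS;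
        try (by left; rewrite ?eqxx ?orbT);
        case: (S2' _ _ _ uvS); rewrite !inE eqxx ?orbT.
    case: (eqVneq (face v u) f1) => [/(m1 _ _ vu)|vu1]; last by right; rewrite vuS.
    by rewrite !inE; do 5? case/orP; case/eqP=> ev eu; move: uv1 uv2 uvS;
      rewrite ev eu ?f26 ?f23 ?eqxx // => uv1 uv2 uvS;
      try (by left; rewrite ?eqxx ?orbT);
      case: (S2' _ _ _ uvS); rewrite !inE eqxx ?orbT.
- by apply: contraTneq (next2_neq yc') => E; rewrite e1 E eqxx.
- by have := next3 FS c'z; rewrite e4 -/y => ->.
- by apply: contraTneq (next2_neq za') => E; rewrite e3 E eqxx.
- by have := next3 FS a'y; rewrite e2 -/z => ->.
Qed.

(** The face of (a, b) follows the cycle up to (d, a) and then leaves [a] towards [next a d]; as it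
    passes through [a] only once, this is [b]. *)
Lemma no_single_turn a b c d : four_cycle a b c d ->
  next b a = c -> next c b = d -> next d c = a -> next a d = b.
Proof.
move=> [ab bc cd da _] tb tc td; have ad : adj a d by rewrite adj_sym.
apply: (face_inj FS (x := a)) => //; first exact: adj_next.
by rewrite (face_stepE FS da) -{1}td (face_stepE FS cd) -{1}tc (face_stepE FS bc)
  -{1}tb (face_stepE FS ab).
Qed.

(** The hypothesis puts the third edge of [b] on the side away from [S]. The eight cases for the
    other three vertices reduce, up to rotating the cycle, to one, two adjacent, two opposite or
    three third edges on the side of [S], all impossible. *)
Lemma four_cycle_facial S a b c d : four_cycle a b c d -> bounds S a b c d ->
  next b a = c -> [/\ next c b = d, next d c = a & next a d = b].
Proof.
move=> Cy Bd tb; case: (Cy) => ab bc cd da [ac bd].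
have [ba cb dc ad] : [/\ adj b a, adj c b, adj d c & adj a d].
  by split; rewrite adj_sym.
have [ca db] : c != a /\ d != b by split; rewrite eq_sym.
have [Cy1 Bd1] := (four_cycle_rot Cy, bounds_rot Bd).
have [Cy2 Bd2] := (four_cycle_rot Cy1, bounds_rot Bd1).
have [Cy3 Bd3] := (four_cycle_rot Cy2, bounds_rot Bd2).
case: (eqVneq (next c b) d) => [tc|tc]; case: (eqVneq (next d c) a) => [td|td];
  case: (eqVneq (next a d) b) => [ta|ta] //.
- by case/eqP: ta; apply: no_single_turn Cy tb tc td.
- by case/eqP: td; apply: no_single_turn Cy3 ta tb tc.
- by case: (no_adjacent_turns (ltnSn _) Cy3 Bd3 td ta tb tc).
- by case/eqP: tc; apply: no_single_turn Cy2 td ta tb.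
- by case: (no_opposite_turns (ltnSn _) Cy Bd ta tb tc td).
- by case: (no_adjacent_turns (ltnSn _) Cy2 Bd2 tc td ta tb).
(* With three of them, the reversed cycle has a single turn, at [b]. *)
- have [_ ra] := next_other ad ab db ta.
  have [_ rc] := next_other cb cd bd tc.
  have [_ rd] := next_other dc da ca td.
  have Cyr : four_cycle b a d c by split=> //; split=> //; rewrite eq_sym.
  have rb := no_single_turn Cyr ra rd rc.
  by have := next2_neq ba; rewrite tb rb eqxx.
Qed.

End FourCycles.

(** * Fullerenes *)

Section Fullerene.
Variable G : plane_graph.
Hypothesis fullG : is_46fullerene G.
Local Notation rotation := (Defs.rot G).
Local Notation phi := (face_perm rotation).
Local Notation face := (porbit phi).
Implicit Types (d : dart G).

Definition mk_dart (x y : G) (xy : adj x y) : dart G :=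
  exist (fun d : G * G => adj d.1 d.2) (x, y) xy.

(* The values at a non-adjacent pair are irrelevant. *)
Definition next_nbr (x y : G) : G :=
  oapp (fun d : dart G => dart_head (rotation d)) y (insub (x, y)).

Definition face_at (x y : G) : {set dart G} :=
  oapp (fun d : dart G => face d) set0 (insub (x, y)).

Lemma dart_pair d : (tail d, dart_head d) = val d.
Proof. by rewrite /tail /dart_head -surjective_pairing. Qed.

Lemma next_nbrE d : next_nbr (tail d) (dart_head d) = dart_head (rotation d).
Proof. by rewrite /next_nbr dart_pair valK. Qed.

Lemma face_atE d : face_at (tail d) (dart_head d) = face d.
Proof. by rewrite /face_at dart_pair valK. Qed.

Lemma dart_eq d d' : tail d = tail d' -> dart_head d = dart_head d' -> d = d'.
Proof. by move=> t h; apply: val_inj; rewrite -!dart_pair t h. Qed.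

Lemma tail_rot d : tail (rotation d) = tail d.
Proof.
have : rotation d \in porbit rotation d by rewrite -{1}[rotation]expg1 mem_porbit.
by rewrite rotP inE => /eqP.
Qed.

Lemma card_darts_at (x : G) : #|[set d | tail d == x]| = 3.
Proof.
have [cub _ _] := fullG; rewrite -(cub x).
rewrite -(@card_in_imset _ _ (@dart_head G)) => [|d d']; last first.
  by rewrite !inE => /eqP t /eqP t'; apply: dart_eq; rewrite t t'.
apply: eq_card => y; rewrite inE; apply/imsetP/idP => [[d]|xy].
  by rewrite inE => /eqP <- ->; apply: adj_dart.
by exists (mk_dart xy); rewrite ?inE.
Qed.

Lemma card_porbit_rot d : #|porbit rotation d| = 3.
Proof. by rewrite rotP card_darts_at. Qed.

Lemma card_face d : (#|face d| == 4) || (#|face d| == 6).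
Proof.
have [_ bd _] := fullG.
by case/orP: (bd _ (face_of_dart d)) => /andP[-> _]; rewrite ?orbT.
Qed.

(** By [bounded_by_cycle], a face has as many tails as darts. *)
Lemma tail_inj_face d d' : face d = face d' -> tail d = tail d' -> d = d'.
Proof.
have [_ bd _] := fullG; move=> E t.
have ti : {in face d &, injective (@tail G)}.
  apply/imset_injP; case/orP: (bd _ (face_of_dart d)) => /andP[/eqP -> /eqP h];
    by apply/eqP.
by apply: ti; rewrite ?porbit_id // E porbit_id.
Qed.

Lemma head_face_perm d : dart_head (phi d) = next_nbr (dart_head d) (tail d).
Proof. by rewrite /face_perm permM permE -next_nbrE. Qed.

Lemma iter_face_step k d :
  iter k (face_step next_nbr) (tail d, dart_head d)
  = (tail (iter k phi d), dart_head (iter k phi d)).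
Proof.
elim: k => //= k ->; rewrite /face_step /=.
by rewrite tail_face_perm head_face_perm.
Qed.

Lemma traject_face_step k d :
  traject (face_step next_nbr) (tail d, dart_head d) k
  = [seq (tail d', dart_head d') | d' <- traject phi d k].
Proof.
elim: k d => //= k IH d; rewrite -IH /face_step /=.
by rewrite tail_face_perm head_face_perm.
Qed.

Lemma fullerene_bipartite :
  exists c : G -> bool, forall x y, adj x y -> c x != c y.
Proof.
apply: even_faces_bipartite => f /imsetP[d _ ->].
by case/orP: (card_face d) => /eqP ->.
Qed.

Lemma fullerene_face_system : face_system next_nbr face_at.
Proof.
have rot3 d : rotation (rotation (rotation d)) = d.
  by have := iter_porbit rotation d; rewrite card_porbit_rot.
have next2 d : next_nbr (tail d) (dart_head (rotation d))
    = dart_head (rotation (rotation d)) by rewrite -(tail_rot d) next_nbrE.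
split=> [x y xy|x y xy|x y xy|x y z xy xz|x y xy|x y z xy xz|x y xy|x y u v xy uv|].
- by have := adj_dart (rotation (mk_dart xy)); rewrite tail_rot -next_nbrE.
- have := next2 (rotation (mk_dart xy)).
  by rewrite rot3 tail_rot -next2 -next_nbrE.
- pose d := mk_dart xy; have := uniq_traject_porbit rotation d.
  rewrite card_porbit_rot /= !inE negb_or => /andP[/andP[rd _] _].
  rewrite (next_nbrE d); apply: contra rd => /eqP E; apply/eqP/esym/dart_eq => //.
  by rewrite tail_rot.
- pose d := mk_dart xy; have : mk_dart xz \in porbit rotation d by rewrite rotP inE.
  rewrite porbit_traject card_porbit_rot !inE (next_nbrE d) (next2 d).
  case/or3P=> /eqP/(congr1 (@dart_head G)) E; apply/or3P;
    by [constructor 1; exact/eqP | constructor 2; exact/eqP | constructor 3; exact/eqP].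
- have := face_next (mk_dart xy).
  by rewrite -!face_atE tail_face_perm head_face_perm.
- rewrite -[face_at x y]/(face_at (tail (mk_dart xy)) (dart_head (mk_dart xy))).
  rewrite -[face_at x z]/(face_at (tail (mk_dart xz)) (dart_head (mk_dart xz))) !face_atE.
  by move/tail_inj_face => /(_ erefl) /(congr1 (@dart_head G)).
- pose d := mk_dart xy; rewrite -[(x, y)]/(tail d, dart_head d) !iter_face_step.
  have := iter_porbit phi d.
  by case/orP: (card_face d) => /eqP -> E; [left|right]; rewrite E.
- pose d := mk_dart xy; rewrite -[face_at x y]/(face_at (tail d) (dart_head d)).
  rewrite -[face_at u v]/(face_at (tail (mk_dart uv)) (dart_head (mk_dart uv))) !face_atE.
  move=> E; have : mk_dart uv \in face d by rewrite -E porbit_id.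
  rewrite porbit_traject -[(x, y)]/(tail d, dart_head d) traject_face_step => m.
  apply/mapP; exists (mk_dart uv) => //; move: m.
  case/orP: (card_face d) => /eqP -> //.
  (* For a square, the four darts are a prefix of the trajectory of length 6. *)
  by rewrite -[6]/(4 + 2) trajectD mem_cat => ->.
- exact: fullerene_bipartite.
Qed.

Local Notation nx := next_nbr.
Let FS := fullerene_face_system.

(** The edge set of the cycle has even degrees, hence is the boundary of a set of faces; this set or
    its complement lies on the left. *)
Lemma four_cycle_bounds (a b c d : G) : four_cycle a b c d ->
  exists S, bounds face_at S a b c d.
Proof.
move=> Cy; case: (Cy) => ab bc cd da [ac bd].
pose C : {set {set G}} := [set [set a; b]; [set b; c]; [set c; d]; [set d; a]].
have CE (x y : G) : ([set x; y] \in C) =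
    ((x, y) \in cycle_darts a b c d) || ((y, x) \in cycle_darts a b c d).
  have pE (p q : G) : ([set x; y] == [set p; q]) =
      ((x, y) == (p, q)) || ((y, x) == (p, q)).
    apply/eqP/orP => [/set2_eq[[-> ->]|[-> ->]]|[]/eqP[-> ->]] //;
      by [left | right | rewrite setUC].
  rewrite !inE !pE.
  by do ![case: (_ == _)].
have [ba cb dc ad] : [/\ adj b a, adj c b, adj d c & adj a d].
  by split; rewrite adj_sym.
have [ca db] : c != a /\ d != b by split; rewrite eq_sym.
have neqs := (negPf ac, negPf bd, negPf ca, negPf db, negPf (adj_neq ab),
  negPf (adj_neq bc), negPf (adj_neq cd), negPf (adj_neq da), negPf (adj_neq ba),
  negPf (adj_neq cb), negPf (adj_neq dc), negPf (adj_neq ad)).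
have evenC (x : G) : ~~ odd #|[set y | adj x y && ([set x; y] \in C)]|.
  have [xac|nac] := boolP ((x == a) || (x == c)).
    rewrite (_ : [set y | _] = [set b; d]) ?cards2 ?bd //; apply/setP => y.
    rewrite [LHS]inE CE !inE !xpair_eqE; case/orP: xac => /eqP ->;
      rewrite !neqs !eqxx /= ?andbT ?andbF ?orbF;
      by case: eqP => [->|_]; case: eqP => [->|_]; rewrite ?ab ?ad ?cb ?cd ?andbF.
  have [xbd|nbd] := boolP ((x == b) || (x == d)).
    rewrite (_ : [set y | _] = [set a; c]) ?cards2 ?ac //; apply/setP => y.
    rewrite [LHS]inE CE !inE !xpair_eqE; case/orP: xbd => /eqP ->;
      rewrite !neqs !eqxx /= ?andbT ?andbF ?orbF;
      by case: eqP => [->|_]; case: eqP => [->|_]; rewrite ?ba ?da ?bc ?dc ?andbF.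
  rewrite (_ : [set y | _] = set0) ?cards0 //; apply/setP => y.
  move: nac nbd; rewrite !negb_or => /andP[/negPf xa /negPf xc] /andP[/negPf xb /negPf xd].
  by rewrite [LHS]inE CE !inE !xpair_eqE xa xb xc xd !andbF.
have [S SE] := even_set_boundary evenC.
have FE x y (xy : adj x y) :
    ([set x; y] \in C) = (face_at x y \in S) (+) (face_at y x \in S).
  have yx : adj y x by rewrite adj_sym.
  have := SE (mk_dart xy); rewrite (_ : rev_dart _ = mk_dart yx); last exact: val_inj.
  by rewrite -!face_atE.
(* The third edge at [q] is not in [C], so membership in [S] does not change from one dart of the
   cycle to the next. *)
have turn (p q r : G) : adj p q -> adj q r -> p != r -> [set p; q] \in C ->
    [set q; r] \in C -> (forall x, x != p -> x != r -> [set q; x] \notin C) ->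
    (face_at p q \in S) = (face_at q r \in S).
  move=> pq qr pr pqC qrC oth; have qp : adj q p by rewrite adj_sym.
  case: (eqVneq (nx q p) r) => [<-|n]; first by rewrite (face_stepE FS pq).
  have [n1 _] := next_other FS qp qr pr n; have qx := adj_next FS qp.
  have xq : adj (nx q p) q by rewrite adj_sym.
  rewrite -(face_stepE FS pq) -n1 (face_stepE FS xq).
  have := FE _ _ qx; rewrite (negPf (oth _ _ n)) ?(next_neq FS qp) //.
  by case: (_ \in S); case: (_ \in S).
have T1 : (face_at a b \in S) = (face_at b c \in S).
  apply: turn => //; rewrite ?CE ?inE ?eqxx ?orbT // => x xa xc.
  by rewrite CE !inE !xpair_eqE !neqs (negPf xa) (negPf xc) ?andbF.
have T2 : (face_at b c \in S) = (face_at c d \in S).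
  apply: turn => //; rewrite ?CE ?inE ?eqxx ?orbT // => x xa xc.
  by rewrite CE !inE !xpair_eqE !neqs (negPf xa) (negPf xc) ?andbF.
have T3 : (face_at c d \in S) = (face_at d a \in S).
  apply: turn => //; rewrite ?CE ?inE ?eqxx ?orbT // => x xa xc.
  by rewrite CE !inE !xpair_eqE !neqs (negPf xa) (negPf xc) ?andbF.
wlog abS : S {SE turn} FE T1 T2 T3 / face_at a b \in S.
  move=> W; case: (boolP (face_at a b \in S)) => [|abS]; first exact: W.
  apply: (W (~: S)); rewrite ?inE ?T1 ?T2 ?T3 -?T3 -?T2 -?T1 //.
  by move=> x y xy; rewrite !in_setC FE //; case: (_ \in S); case: (_ \in S).
have cyS x y : (x, y) \in cycle_darts a b c d -> face_at x y \in S.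
  move: x y; apply: (cycle_darts_ind (P := fun x y => face_at x y \in S));
    by rewrite -?T3 -?T2 -?T1.
have cyA x y : (x, y) \in cycle_darts a b c d -> adj x y.
  by move: x y; apply: (cycle_darts_ind (P := fun x y => adj x y)).
exists S; split=> // x y.
  by move=> xyC; have := FE _ _ (cyA _ _ xyC); rewrite CE xyC cyS //=.
move=> xy xyS; have := FE _ _ xy; rewrite CE xyS.
case: (boolP ((x, y) \in _)) => [|_] /=; first by left.
case: (boolP ((y, x) \in _)) => [/cyS -> //|_]; by case: (_ \in S); [right|].
Qed.

Lemma fullerene_facial (a b c d : G) : four_cycle a b c d -> nx b a = c ->
  [/\ nx c b = d, nx d c = a & nx a d = b].
Proof.
by move=> Cy; have [S Bd] := four_cycle_bounds Cy; apply: (four_cycle_facial FS Cy Bd).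
Qed.

(** Otherwise [x] and [y] have the same three neighbours. Two facial 4-cycles then run through [x],
    [p], [y], one on each side, leaving no room for the third edge at [p]. *)
Lemma fullerene_K23 (x y : G) : x != y -> #|neighbours x :&: neighbours y| <= 2.
Proof.
move=> nxy; rewrite leqNgt; apply/negP => gt2; have [cub _ _] := fullG.
have xy_sub z : adj x z -> adj y z.
  have : neighbours x :&: neighbours y == neighbours x.
    by rewrite eqEcard subsetIl cub.
  by move/eqP/setP/(_ z); rewrite !inE => E xz; move: E; rewrite xz.
have [p xp] : exists p, adj x p.
  have : 0 < #|neighbours x| by rewrite cub.
  by case/card_gt0P=> p; rewrite inE; exists p.
have xq := adj_next FS xp; have xr := adj_next FS xq.
set q := nx x p in xq xr; set r := nx x q in xr.
have Cy1 : four_cycle p x q y.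
  split; rewrite ?xy_sub // 1?adj_sym ?xy_sub //; split=> //.
  by rewrite eq_sym (next_neq FS xp).
have Cy2 : four_cycle r x p y.
  by split; rewrite ?xy_sub // 1?adj_sym ?xy_sub //; split=> //; rewrite (next2_neq FS xp).
have [_ _ e1] := fullerene_facial Cy1 erefl.
have [e2 _ _] := fullerene_facial Cy2 (next3 FS xp).
by have := next2_neq FS (_ : adj p x); rewrite e2 e1 eqxx adj_sym => /(_ xp).
Qed.

Lemma sum_faces (F : {set dart G} -> nat) :
  \sum_d F (face d) = \sum_(f in faces G) #|f| * F f.
Proof.
rewrite (partition_big (fun d => face d) (mem (faces G))) /= => [|d _]; last first.
  exact: face_of_dart.
apply: eq_bigr => _ /imsetP[d0 _ ->]; rewrite -sum_nat_const.
apply: eq_big => [d|d /eqP -> //].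
by rewrite eq_porbit_mem.
Qed.

Lemma sum_square_hexagon (w : nat -> nat) (h : nat) : num_faces G 6 = h ->
  \sum_(f in faces G) w #|f| = 6 * w 4 + h * w 6.
Proof.
have [_ bd sq] := fullG => <-.
have -> : 6 * w 4 = num_faces G 4 * w 4 by rewrite sq.
rewrite (bigID (fun f => bounded_by_cycle 4 f)) /=; congr addn.
  rewrite (eq_bigr (fun=> w 4)) => [|f /andP[_ /andP[/eqP -> _]] //].
  rewrite sum_nat_const; congr (_ * _); apply: eq_card => f.
  by rewrite !inE.
rewrite (eq_bigr (fun=> w 6)) => [|f /andP[/bd /orP[->//|/andP[/eqP -> _]]] //].
rewrite sum_nat_const; congr (_ * _); apply: eq_card => f.
rewrite !inE; apply/andP/andP => -[fG fk]; split=> //.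
  by move: (bd _ fG); rewrite (negPf fk).
by apply: contraTN fk => /andP[/eqP f4 _]; rewrite /bounded_by_cycle f4.
Qed.

(** Counting darts by tails and by faces gives 3n = 24 + 6h. *)
Lemma card_fullerene (h : nat) : num_faces G 6 = h -> #|G| = 2 * h + 8.
Proof.
move=> hexG; have : #|{: dart G}| = #|G| * 3.
  rewrite -sum1_card (partition_big (@tail G) xpredT) //=.
  rewrite (eq_bigr (fun=> 3)) ?sum_nat_const // => x _.
  by rewrite sum1_card -(card_darts_at x); apply: eq_card => d; rewrite !inE.
have := sum_square_hexagon id hexG.
have -> : \sum_(f in faces G) id #|f| = #|{: dart G}|.
  rewrite -sum1_card (sum_faces (fun=> 1)); by apply: eq_bigr => f _; rewrite muln1.
lia.
Qed.

Lemma card_square_darts : #|[set d | #|face d| == 4]| = 24.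
Proof.
rewrite -sum1dep_card big_mkcond /= (sum_faces (fun f => if #|f| == 4 then 1 else 0)).
by rewrite (sum_square_hexagon (fun k => k * if k == 4 then 1 else 0) erefl) muln0.
Qed.

(** * The labelled 4-cycles *)

Section Squares.
Variable x0 : G.

Lemma tuple4P (t : 4.-tuple G) : exists a b c d : G, t = [tuple a; b; c; d].
Proof.
case/tupleP: t => a t; case/tupleP: t => b t; case/tupleP: t => c t.
case/tupleP: t => d t; exists a, b, c, d; apply: val_inj => /=.
by rewrite (tuple0 t).
Qed.

Lemma embeds_C4P (a b c d : G) :
  reflect (four_cycle a b c d) (embeds x0 C4_pattern [:: a; b; c; d]).
Proof.
rewrite /embeds /= !inE !negb_or !andbT.
apply: (iffP idP) => [/andP[/and3P[/and3P[_ ac _] /andP[_ bd] _] /and4P[]]|] //.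
case=> ab bc cd da [ac bd]; rewrite ab bc cd da ac bd !adj_neq //.
by rewrite adj_sym.
Qed.

(** These 4-cycles follow a face at their second vertex, hence everywhere by [fullerene_facial]. *)
Definition squares_left : {set 4.-tuple G} :=
  [set t : 4.-tuple G | embeds x0 C4_pattern t
    && (nx (nth x0 t 1) (nth x0 t 0) == nth x0 t 2)].

Definition square_of (d : dart G) : 4.-tuple G :=
  [tuple tail d; tail (phi d); tail (phi (phi d)); tail (phi (phi (phi d)))].

(** Such a cycle is determined by its first dart, which can be any dart of a square face. *)
Lemma card_squares_left : #|squares_left| = 24.
Proof.
rewrite -card_square_darts -(card_in_imset (f := square_of)) => [|d d' _ _]; last first.
  move/(congr1 val) => /= [t h _ _]; apply: dart_eq => //.
  by move: h; rewrite !tail_face_perm.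
apply: eq_card => t; rewrite inE; have [a [b [c [d ->]]]] := tuple4P t.
apply/andP/imsetP => [[/embeds_C4P Cy /eqP /= tb]|[e]].
  have [tc td ta] := fullerene_facial Cy tb; case: (Cy) => ab bc cd da _.
  pose e := mk_dart ab.
  have s1 : (tail (phi e), dart_head (phi e)) = (b, c).
    by rewrite tail_face_perm head_face_perm /= tb.
  have s2 : (tail (phi (phi e)), dart_head (phi (phi e))) = (c, d).
    by case: s1 => t1 h1; rewrite head_face_perm tail_face_perm t1 h1 tc.
  have s3 : (tail (phi (phi (phi e))), dart_head (phi (phi (phi e)))) = (d, a).
    by case: s2 => t2 h2; rewrite head_face_perm tail_face_perm t2 h2 td.
  have s4 : phi (phi (phi (phi e))) = e.
    case: s3 => t3 h3; apply: dart_eq; first by rewrite tail_face_perm h3.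
    by rewrite head_face_perm t3 h3 ta.
  exists e; last first.
    by apply: val_inj; case: s1 s2 s3 => /= -> _ [-> _] [-> _].
  (* On a hexagon, the fourth successor of [e] would differ from [e]. *)
  rewrite inE; case/orP: (card_face e) => // /eqP e6.
  have := uniq_traject_porbit phi e; rewrite e6 /= s4.
  by rewrite !inE eqxx !orbT.
rewrite inE => /eqP e4 /(congr1 val) /= [ea eb ec ed].
have s4 : phi (phi (phi (phi e))) = e by have := iter_porbit phi e; rewrite e4.
have st d' : adj (tail d') (tail (phi d')) by rewrite tail_face_perm adj_dart.
have ab : adj a b by rewrite ea eb.
have bc : adj b c by rewrite eb ec.
have cd : adj c d by rewrite ec ed.
have da : adj d a by rewrite ed ea -{2}s4.
have uq := uniq_traject_porbit phi e; rewrite e4 /= !inE !negb_or in uq.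
case/and4P: uq => /and3P[_ e02 _] /andP[_ e13] _ _.
split; last first.
  rewrite /= ea eb ec [tail (phi e)]tail_face_perm -head_face_perm.
  by rewrite [tail (phi (phi _))]tail_face_perm.
apply/embeds_C4P; split=> //; split.
  by apply: contra e02 => /eqP E; apply/eqP/tail_inj_face; rewrite ?face_next // -ea -ec.
by apply: contra e13 => /eqP E; apply/eqP/tail_inj_face; rewrite ?face_next // -eb -ed.
Qed.

(** Since [b] has degree 3, exactly one of [next_nbr b a = c] and [next_nbr b c = a] holds. So [r],
    which reverses the cycle while fixing [b] and [d], exchanges [squares_left] with its
    complement. *)
Lemma fullerene_C4 : emb x0 4 C4_pattern = 48.
Proof.
pose r (t : 4.-tuple G) :=
  [tuple tnth t (inord 2); tnth t (inord 1); tnth t ord0; tnth t (inord 3)].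
have rE (a b c d : G) : r [tuple a; b; c; d] = [tuple c; b; a; d].
  by rewrite /r !(tnth_nth x0) /= !inordK.
have rr : involutive r.
  by move=> t; have [a [b [c [d ->]]]] := tuple4P t; rewrite !rE.
pose E : {set 4.-tuple G} := [set t : 4.-tuple G | embeds x0 C4_pattern t].
have -> : emb x0 4 C4_pattern = #|E|.
  rewrite /emb -sum1_card [RHS]big_mkcond /=; apply: eq_bigr => t _.
  by rewrite inE; case: (embeds _ _ _).
have LE : squares_left \subset E by apply/subsetP => t; rewrite !inE => /andP[].
rewrite -(cardsID squares_left E) (setIidPr LE) card_squares_left.
have -> : E :\: squares_left = r @: squares_left.
  apply/setP => t; have [a [b [c [d ->]]]] := tuple4P t.
  rewrite -(rr [tuple a; b; c; d]) (mem_imset _ _ (inv_inj rr)) rr rE !inE /=.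
  have Cyr (p q s u : G) : four_cycle p q s u -> four_cycle s q p u.
    by case=> pq qs su up [ps qu]; split; rewrite 1?adj_sym //; split; rewrite // eq_sym.
  case: (embeds_C4P a b c d) => [Cy|nCy]; case: (embeds_C4P c b a d) => [Cy'|nCy'].
  - rewrite andbT /=; case: Cy Cy' => ab bc _ _ [ac _] _.
    have ba : adj b a by rewrite adj_sym.
    apply/idP/idP => [/(next_other FS ba bc ac)[_ ->] //|/eqP e].
    by apply: contraTneq (next2_neq FS bc) => e'; rewrite e e' eqxx.
  - by case: nCy'; apply: Cyr.
  - by case: nCy; apply: Cyr.
  - by rewrite andbF.
by rewrite (card_imset _ (inv_inj rr)) card_squares_left.
Qed.

End Squares.

Lemma fullerene_is_fullerene_like (x0 : G) (h : nat) :
  num_faces G 6 = h -> fullerene_like x0 h.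
Proof.
move=> hexG; split; first exact: card_fullerene.
- by case: fullG.
- exact: fullerene_bipartite.
- exact: fullerene_K23.
- exact: fullerene_C4.
Qed.

(** This provides the default vertex that the list encoding of copies requires. *)
Lemma fullerene_vertex : exists x0 : G, True.
Proof.
have [_ _ sq] := fullG.
have : 0 < num_faces G 4 by rewrite sq.
by case/card_gt0P=> f; rewrite inE => /andP[/imsetP[d _ _] _]; exists (tail d).
Qed.

End Fullerene.

(** Denominators are cleared and negative terms moved across, so that the formulas live in [nat];
    large coefficients are written as products to keep unary numerals small. *)
Lemma fullerene_counts (G : plane_graph) (h : nat) :
  is_46fullerene G -> num_faces G 6 = h ->
  [/\ 8 * num_matchings G 4 =
        72 + 234 * h + 273 * h ^ 2 + 162 * h ^ 3 + 27 * h ^ 4,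
      40 * num_matchings G 5 + 216 * h + 45 * h ^ 3 =
        390 * h ^ 2 + 270 * h ^ 4 + 81 * h ^ 5
    & 240 * num_matchings G 6 + 3840 + 2952 * h + 6 * 2833 * h ^ 2
        + 1485 * h ^ 4 + 243 * h ^ 5 =
        15 * 405 * h ^ 3 + 243 * h ^ 6 + 40 * num_subgraphs graphQ G].
Proof.
move=> fullG hexG; have [x0 _] := fullerene_vertex fullG.
have [] := emb_values (fullerene_is_fullerene_like fullG x0 hexG).
rewrite (emb_matching x0 4) (emb_matching x0 5) (emb_matching x0 6) (emb_Q x0).
have [-> -> ->] : [/\ 2 ^ 4 * 4`! = 384, 2 ^ 5 * 5`! = 3840 & 2 ^ 6 * 6`! = 48 * 960].
  by [].
(* The number of labelled hexagons is eliminated between [e6] and [eQ]. *)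
by rewrite !expnS expn0 => e4 e5 e6 eQ; split; lia.
Qed.

Local Open Scope ring_scope.

Theorem theorem3p7 (G : plane_graph) (h : nat)
    (fullG : is_46fullerene G) (hexG : num_faces G 6 = h) :
  let x : rat := h%:R in
  [/\ (num_matchings G 4)%:R =
        27 / 8 * x ^+ 4 + 81 / 4 * x ^+ 3 + 273 / 8 * x ^+ 2
        + 117 / 4 * x + 9 :> rat,
      (num_matchings G 5)%:R =
        81 / 40 * x ^+ 5 + 27 / 4 * x ^+ 4 - 9 / 8 * x ^+ 3
        + 39 / 4 * x ^+ 2 - 27 / 5 * x :> rat
    & (num_matchings G 6)%:R =
        81 / 80 * x ^+ 6 - 81 / 80 * x ^+ 5 - 99 / 16 * x ^+ 4
        + 405 / 16 * x ^+ 3 - 2833 / 40 * x ^+ 2 - 123 / 10 * x - 16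
        + (num_subgraphs graphQ G)%:R / 6 :> rat].
Proof.
have toQ (m n : nat) : m = n -> m%:R = n%:R :> rat by move->.
have [/toQ e4 /toQ e5 /toQ e6] := fullerene_counts fullG hexG.
rewrite !(natrD, natrM, natrX) in e4 e5 e6.
by move=> x; split; lra.
Qed.
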